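(* For a continuous map $f\colon[0,1]\to[0,1]$ the following are equivalent: (i) $h_{top}(f)>0$; (ii) $\mathrm{Prox}(f)\setminus\mathrm{SProx}(f)\ne\emptyset$; (iii) there are $\varepsilon>0$ and an $\varepsilon$-scrambled set $S\subset[0,1]$ for $f$ with $(S\times S)\setminus\Delta\subset\mathrm{Prox}(f)\setminus\mathrm{SProx}(f)$.
   Context: $h_{top}$ is topological entropy; $\Delta$ is the diagonal. $\mathrm{Asy}(f)=\{(x,y):|f^nx-f^ny|\to0\}$, $\mathrm{Prox}(f)=\{(x,y):\liminf_n|f^nx-f^ny|=0\}$, $\mathrm{SProx}(f)=\{(x,y):\{n:|f^nx-f^ny|<\eta\}$ syndetic for all $\eta>0\}$, where syndetic means meeting every subset of $\mathbb N$ with arbitrarily long runs of consecutive integers. A set $S$ with at least two points is $\varepsilon$-scrambled if every pair of distinct $x,y\in S$ lies in $\mathrm{Prox}(f)\setminus\mathrm{Asy}(f)$ and $\limsup_n|f^nx-f^ny|\ge\varepsilon$. *)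

(* Defs.v *)
From Stdlib Require Import Reals List.
Open Scope R_scope.

Definition I01 (x : R) : Prop := 0 <= x <= 1.

Definition maps_I01 (f : R -> R) : Prop := forall x, I01 x -> I01 (f x).

Definition cont_I01 (f : R -> R) : Prop :=
  forall x, I01 x -> forall eps, eps > 0 ->
    exists delta, delta > 0 /\
      forall y, I01 y -> Rabs (y - x) < delta -> Rabs (f y - f x) < eps.

Definition iter (f : R -> R) (n : nat) (x : R) : R := Nat.iter n f x.

Definition odist (f : R -> R) (x y : R) (n : nat) : R :=
  Rabs (iter f n x - iter f n y).

Definition separated (f : R -> R) (n : nat) (eps : R) (S : list R) : Prop :=
  NoDup S /\ (forall x, In x S -> I01 x) /\
  forall x y, In x S -> In y S -> x <> y ->
    exists k, (k < n)%nat /\ odist f x y k > eps.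

(* h_top(f) = lim_{eps->0} limsup_n (1/n) log s(n,eps), where s(n,eps) is
   the maximal cardinality of an (n,eps)-separated set.  Since the limit in
   eps is a monotone (nondecreasing as eps decreases) limit, h_top(f) > 0
   iff for some eps > 0, limsup_n (1/n) log s(n,eps) > 0, i.e. iff there
   are eps > 0 and c > 0 such that for infinitely many n there is an
   (n,eps)-separated set with at least exp(c n) points.  (h_top may be
   +infinity for interval maps, so we state positivity directly.) *)
Definition pos_entropy (f : R -> R) : Prop :=
  exists eps c, eps > 0 /\ c > 0 /\
    forall N : nat, exists n : nat, (N <= n)%nat /\ (1 <= n)%nat /\
      exists S, separated f n eps S /\ exp (c * INR n) <= INR (length S).

Definition Asy (f : R -> R) (x y : R) : Prop :=
  forall eta, eta > 0 -> exists N : nat, forall n, (N <= n)%nat -> odist f x y n < eta.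

Definition Prox (f : R -> R) (x y : R) : Prop :=
  forall eta, eta > 0 -> forall N : nat, exists n, (N <= n)%nat /\ odist f x y n < eta.

Definition thick (B : nat -> Prop) : Prop :=
  forall L : nat, exists m : nat, forall i, (i < L)%nat -> B (m + i)%nat.

Definition syndetic (A : nat -> Prop) : Prop :=
  forall B, thick B -> exists n, A n /\ B n.

Definition SProx (f : R -> R) (x y : R) : Prop :=
  forall eta, eta > 0 -> syndetic (fun n => odist f x y n < eta).

Definition limsup_ge (f : R -> R) (x y eps : R) : Prop :=
  forall delta, delta > 0 -> forall N : nat,
    exists n, (N <= n)%nat /\ odist f x y n > eps - delta.

Definition scrambled (f : R -> R) (eps : R) (S : R -> Prop) : Prop :=
  (exists x y, S x /\ S y /\ x <> y) /\
  forall x y, S x -> S y -> x <> y ->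
    Prox f x y /\ ~ Asy f x y /\ limsup_ge f x y eps.

(* Main.v *)
Require Import Defs.
From Stdlib Require Import Reals Arith Lra Lia List Classical ClassicalEpsilon.
Open Scope R_scope.

(** Call [f] tame if no iterate of [f] has a horseshoe, i.e. an interval with
two subintervals without common interior points that both cover it.

If [f] is not tame, words over the two legs of a horseshoe give exponentially
many separated orbits, and also two points that repeatedly enter a common short
interval and then follow different legs for longer and longer times.

If [f] is tame, then its entropy is zero: cut [0,1] into short intervals; the
image of a piece consists of full pieces and at most two partial ones, and for
every length there is at most one chain of coverings from a piece to itself, so
that the number of itineraries of length [n] is at most polynomial times [2^n].
Applied to a high iterate of [f], this contradicts positive entropy.

If [f] is tame, then moreover every proximal pair is syndetically proximal. An
orbit accumulating at a periodic point converges to its cycle. Otherwise both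
orbits eventually alternate in phase between the two sides of one fixed point;
repeating this for [f^2], [f^4], ... on the shorter side puts both orbits in an
interval of length [2^-k] along an arithmetic progression of times. *)

(** * Iterates, coverings and horseshoes *)

(** A point that moves away from a fixed point $z$ of a tame map cannot return to $z$: a backward
    orbit of the point towards $z$, combined with the return, would form a horseshoe. [stay_away]
    sharpens this to a positive distance, and that distance is what constrains proximal pairs: if a
    point of one orbit that moves down lay below a point of the other that moves up, fixed points in
    between would keep the two orbits apart forever. Powers of a tame map are tame, so all this is
    available for every power.

    The counting argument bounds the growth rate of a tame map only by $\log 2$, not by zero. But
    this bound is the same for all tame maps, whereas passing from $f$ to $f^m$ multiplies the rate
    $c$ of $f$ by $m$; once $cm\ge 3$ the two are incompatible. Chains from a piece to itself are
    unique because two of equal length would yield two subintervals of the piece, without common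
    interior points, that cover the piece under one iterate. *)

Lemma iter_S (g : R -> R) (n : nat) (x : R) : iter g (S n) x = g (iter g n x).
Proof. reflexivity. Qed.

Lemma iter_add (g : R -> R) (m n : nat) (x : R) :
  iter g (m + n) x = iter g m (iter g n x).
Proof. induction m as [|m IH]; [reflexivity|]. now rewrite Nat.add_succ_l, !iter_S, IH. Qed.

Lemma iter_S_r (g : R -> R) (n : nat) (x : R) : iter g (S n) x = iter g n (g x).
Proof. replace (S n) with (n + 1)%nat by lia. apply iter_add. Qed.

Lemma iter_mul (g : R -> R) (m n : nat) (x : R) :
  iter (iter g m) n x = iter g (n * m) x.
Proof.
  induction n as [|n IH]; [reflexivity|].
  rewrite iter_S, IH. exact (eq_sym (iter_add g m (n * m) x)).
Qed.

Lemma iter_fix (g : R -> R) (n : nat) (z : R) : g z = z -> iter g n z = z.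
Proof. intros Hz; induction n as [|n IH]; [reflexivity|]. now rewrite iter_S, IH. Qed.

(** Continuity is required on the whole line, so that results on total functions apply directly;
    [extend] brings a map of $[0,1]$ into this form without changing its orbits there. *)
Definition interval_map (g : R -> R) : Prop :=
  continuity g /\ forall x, I01 x -> I01 (g x).

Lemma iter_I01 (g : R -> R) (n : nat) (x : R) :
  interval_map g -> I01 x -> I01 (iter g n x).
Proof. intros [_ H] Hx; induction n as [|n IH]; [exact Hx|]. now apply H. Qed.

Lemma iter_continuity (g : R -> R) (n : nat) : continuity g -> continuity (iter g n).
Proof.
  intros H; induction n as [|n IH].
  - intros x; apply derivable_continuous_pt, derivable_pt_id.
  - intros x; apply (continuity_pt_comp (iter g n) g); [apply IH|apply H].
Qed.

Lemma interval_map_iter (g : R -> R) (n : nat) :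
  interval_map g -> interval_map (iter g n).
Proof.
  intros H; split; [now apply iter_continuity, H|].
  intros x; now apply iter_I01.
Qed.

Lemma continuity_eps (g : R -> R) (x eps : R) : continuity g -> eps > 0 ->
  exists delta, delta > 0 /\ forall y, Rabs (y - x) < delta -> Rabs (g y - g x) < eps.
Proof.
  intros Hg He. destruct (Hg x eps He) as [d [Hd H]].
  exists d; split; [exact Hd|]. intros y Hy.
  destruct (Req_dec y x) as [->|Hne].
  - rewrite Rminus_diag, Rabs_R0; lra.
  - apply H. split; [split; [exact I|congruence]|exact Hy].
Qed.

Lemma ivt (g : R -> R) (a b u v y : R) : continuity g ->
  a <= u <= b -> a <= v <= b -> g u <= y <= g v -> exists x, a <= x <= b /\ g x = y.
Proof.
  intros Hg Hu Hv Hy.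
  assert (Hc : continuity (fun s => g s - y)).
  { apply continuity_minus; [exact Hg|]. apply continuity_const; intros s t; reflexivity. }
  destruct (Rle_dec u v) as [Huv|Huv].
  - destruct (IVT_cor (fun s => g s - y) u v Hc Huv) as [x [Hx E]]; [nra|].
    exists x; split; lra.
  - destruct (IVT_cor (fun s => g s - y) v u Hc ltac:(lra)) as [x [Hx E]]; [nra|].
    exists x; split; lra.
Qed.

(** The witness is the supremum of the points of $[s,t]$ at which $g\le c$. *)
Lemma last_point (g : R -> R) (s t c : R) : continuity g -> s < t ->
  g s <= c < g t -> exists u, s <= u < t /\ g u = c /\ forall y, u < y <= t -> c < g y.
Proof.
  intros Hg Hst Hc.
  destruct (completeness (fun y => s <= y <= t /\ g y <= c)) as [u [Hub Hlub]].
  { exists t; intros y Hy; lra. }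
  { exists s; split; lra. }
  assert (Hsu : s <= u) by (apply Hub; split; lra).
  assert (Hut : u <= t) by (apply Hlub; intros y Hy; lra).
  assert (Hle : g u <= c).
  { apply Rnot_lt_le; intros Hlt.
    destruct (continuity_eps g u (g u - c) Hg) as [d [Hd H]]; [lra|].
    assert (u <= u - d); [|lra].
    apply Hlub; intros y [Hy1 Hy2].
    apply Rnot_lt_le; intros Hlt2.
    assert (y <= u) by (apply Hub; split; lra).
    assert (Hy : Rabs (y - u) < d) by (apply Rabs_def1; lra).
    apply H in Hy. apply Rabs_def2 in Hy. lra. }
  assert (Hafter : forall y, u < y <= t -> c < g y).
  { intros y Hy. apply Rnot_le_lt; intros Hyc.
    assert (y <= u) by (apply Hub; split; lra). lra. }
  assert (Hne : u <> t) by (intros ->; lra).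
  exists u; split; [lra|split; [|exact Hafter]].
  apply Rle_antisym; [exact Hle|].
  apply Rnot_lt_le; intros Hlt.
  destruct (ivt g u t u t c Hg) as [x [Hx E]]; [lra..|].
  assert (x <> u) by (intros ->; lra).
  specialize (Hafter x). lra.
Qed.

(** This is [last_point] for $y\mapsto -g(-y)$, whose graph is that of $g$ after a half turn. *)
Lemma first_point (g : R -> R) (s t c : R) : continuity g -> s < t ->
  g s < c <= g t -> exists u, s < u <= t /\ g u = c /\ forall y, s <= y < u -> g y < c.
Proof.
  intros Hg Hst Hc.
  assert (Hr : continuity (fun y => - g (- y))).
  { apply (continuity_opp (fun y => g (- y))).
    apply (continuity_comp (fun y => - y) g); [|exact Hg].
    apply (continuity_opp (fun y => y)). apply derivable_continuous, derivable_id. }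
  destruct (last_point (fun y => - g (- y)) (- t) (- s) (- c) Hr) as [u [Hu [E H]]];
    [lra|rewrite !Ropp_involutive; lra|].
  exists (- u); split; [lra|split; [lra|]].
  intros y Hy. specialize (H (- y)). rewrite Ropp_involutive in H. lra.
Qed.

(** For continuous $g$ and $c\le d$ this is $[c,d]\subset g([a,b])$, by the intermediate value
    theorem; storing just two witnesses makes the relation easy to shrink and compose. *)
Definition covers (g : R -> R) (a b c d : R) : Prop :=
  (exists u, a <= u <= b /\ g u <= c) /\ (exists v, a <= v <= b /\ d <= g v).

Lemma covers_point (g : R -> R) (a b c d y : R) : continuity g ->
  covers g a b c d -> c <= y <= d -> exists x, a <= x <= b /\ g x = y.
Proof.
  intros Hg [[u [Hu Hu']] [v [Hv Hv']]] Hy.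
  apply (ivt g a b u v y Hg); lra.
Qed.

Lemma covers_trans (g h : R -> R) (a b c d e k : R) : continuity g ->
  covers g a b c d -> covers h c d e k -> covers (fun x => h (g x)) a b e k.
Proof.
  intros Hg H [[u [Hu Hu']] [v [Hv Hv']]].
  destruct (covers_point g a b c d u Hg H Hu) as [u0 [Hu0 Eu]].
  destruct (covers_point g a b c d v Hg H Hv) as [v0 [Hv0 Ev]].
  split; [exists u0|exists v0]; split; try assumption; rewrite ?Eu, ?Ev; assumption.
Qed.

Lemma covers_sub (g : R -> R) (a b c d c' d' : R) :
  covers g a b c d -> c <= c' -> d' <= d -> covers g a b c' d'.
Proof.
  intros [[u [Hu Hu']] [v [Hv Hv']]] Hc Hd.
  split; [exists u|exists v]; split; lra.
Qed.

Lemma covers_iter_add (g : R -> R) (m n : nat) (a b c d e k : R) : continuity g ->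
  covers (iter g n) a b c d -> covers (iter g m) c d e k ->
  covers (iter g (m + n)) a b e k.
Proof.
  intros Hg H1 H2.
  destruct (covers_trans _ _ _ _ _ _ _ _ (iter_continuity g n Hg) H1 H2)
    as [[u [Hu Hu']] [v [Hv Hv']]].
  split; [exists u|exists v]; (split; [assumption|rewrite iter_add; assumption]).
Qed.

Lemma covers_self_iter (g : R -> R) (n : nat) (a b : R) : continuity g -> a <= b ->
  covers g a b a b -> covers (iter g n) a b a b.
Proof.
  intros Hg Hab H; induction n as [|n IH].
  - split; [exists a|exists b]; unfold iter; simpl; lra.
  - exact (covers_trans _ _ _ _ _ _ _ _ (iter_continuity g n Hg) IH H).
Qed.

(* The strict inequalities on the open interval make the pullbacks of two
   intervals without common interior points disjoint in the same sense. *)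
Lemma pullback (g : R -> R) (a b c d : R) : continuity g -> c < d ->
  covers g a b c d ->
  exists u v, a <= u /\ u < v /\ v <= b /\ covers g u v c d /\
    (forall s, u <= s <= v -> c <= g s <= d) /\ forall s, u < s < v -> c < g s < d.
Proof.
  intros Hg Hcd H.
  destruct (covers_point g a b c d c Hg H) as [s [Hs Es]]; [lra|].
  destruct (covers_point g a b c d d Hg H) as [t [Ht Et]]; [lra|].
  assert (Hst : s <> t) by (intros ->; lra).
  destruct (Rlt_dec s t) as [Hlt|Hge].
  (* Between the last visit to $c$ before $t$ and the first visit to $d$ after it, $g$ stays
     strictly between $c$ and $d$. *)
  - destruct (last_point g s t c Hg Hlt) as [u [Hu [Eu Hu']]]; [lra|].
    destruct (first_point g u t d Hg) as [v [Hv [Ev Hv']]]; [lra|lra|].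
    assert (Hin : forall y, u < y < v -> c < g y < d).
    { intros y Hy; split; [apply Hu'|apply Hv']; lra. }
    exists u, v; repeat split; try lra.
    + exists u; lra.
    + exists v; lra.
    + destruct (Req_dec s0 u) as [->|]; [lra|].
      destruct (Req_dec s0 v) as [->|]; [lra|]. specialize (Hin s0); lra.
    + destruct (Req_dec s0 u) as [->|]; [lra|].
      destruct (Req_dec s0 v) as [->|]; [lra|]. specialize (Hin s0); lra.
    + now apply Hin.
    + now apply Hin.
  (* Here $d$ is taken before $c$, so the same argument runs for $-g$. *)
  - assert (Hr : continuity (fun y => - g y)) by now apply (continuity_opp g).
    destruct (last_point (fun y => - g y) t s (- d) Hr) as [u [Hu [Eu Hu']]];
      [lra|lra|].
    destruct (first_point (fun y => - g y) u s (- c) Hr) as [v [Hv [Ev Hv']]];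
      [lra|lra|].
    assert (Hin : forall y, u < y < v -> c < g y < d).
    { intros y Hy; specialize (Hu' y); specialize (Hv' y); lra. }
    exists u, v; repeat split; try lra.
    + exists v; lra.
    + exists u; lra.
    + destruct (Req_dec s0 u) as [->|]; [lra|].
      destruct (Req_dec s0 v) as [->|]; [lra|]. specialize (Hin s0); lra.
    + destruct (Req_dec s0 u) as [->|]; [lra|].
      destruct (Req_dec s0 v) as [->|]; [lra|]. specialize (Hin s0); lra.
    + now apply Hin.
    + now apply Hin.
Qed.

(** Unlike an inequality between end points, this form passes to pullbacks under a map that may
    reverse the order. *)
Definition apart (u v u' v' : R) : Prop := forall s, u < s < v -> ~ u' < s < v'.

Lemma apart_le (u v u' v' : R) : u < v -> u' < v' -> apart u v u' v' ->
  v <= u' \/ v' <= u.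
Proof.
  intros H1 H2 H. destruct (Rle_dec v u') as [|Hn]; [now left|right].
  apply Rnot_lt_le; intros Hlt.
  apply (H ((Rmax u u' + Rmin v v') / 2));
  unfold Rmax, Rmin; destruct (Rle_dec u u'), (Rle_dec v v'); lra.
Qed.

(** The legs may share an end point. They are nondegenerate because each covers $[l,r]$ with
    $l<r$. *)
Definition horseshoe (g : R -> R) : Prop := exists l r a b c d,
  0 <= l /\ l < r /\ r <= 1 /\ l <= a /\ b <= c /\ d <= r /\
  covers g a b l r /\ covers g c d l r.

Definition tame (g : R -> R) : Prop :=
  forall m, (1 <= m)%nat -> ~ horseshoe (iter g m).

Lemma horseshoe_ext (g h : R -> R) :
  (forall x, I01 x -> g x = h x) -> horseshoe g -> horseshoe h.
Proof.
  intros E (l & r & a & b & c & d & H1 & H2 & H3 & H4 & H5 & H6 &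
    [[u [Hu Hu']] [v [Hv Hv']]] & [[w [Hw Hw']] [y [Hy Hy']]]).
  unfold I01 in E.
  exists l, r, a, b, c, d; repeat (split; [assumption|]).
  split; split; [exists u|exists v|exists w|exists y]; (split; [assumption|]);
    rewrite <- E; try assumption; lra.
Qed.

Lemma tame_iter (g : R -> R) (k : nat) : (1 <= k)%nat -> tame g -> tame (iter g k).
Proof.
  intros Hk H m Hm Hh. apply (H (m * k)%nat); [nia|].
  apply (horseshoe_ext (iter (iter g k) m)); [|exact Hh].
  intros x _; apply iter_mul.
Qed.

Lemma apart_horseshoe (g : R -> R) (l r u v u' v' : R) :
  0 <= l -> l < r -> r <= 1 -> l <= u -> u < v -> v <= r -> l <= u' -> u' < v' -> v' <= r ->
  apart u v u' v' -> covers g u v l r -> covers g u' v' l r -> horseshoe g.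
Proof.
  intros ? ? ? ? ? ? ? ? ? Ha ? ?.
  destruct (apart_le u v u' v') as [Hle|Hle]; try assumption.
  - exists l, r, u, v, u', v'; tauto.
  - exists l, r, u', v', u, v; tauto.
Qed.

Lemma pullback_apart (g : R -> R) (u v u' v' c d c' d' : R) :
  apart c d c' d' -> (forall s, u < s < v -> c < g s < d) ->
  (forall s, u' < s < v' -> c' < g s < d') -> apart u v u' v'.
Proof. intros H H1 H2 s Hs Hs'. apply (H (g s)); auto. Qed.

(** Conjugation by $x\mapsto 1-x$ turns statements about points moving up into statements about
    points moving down. *)
Definition mirror (g : R -> R) (x : R) : R := 1 - g (1 - x).

Lemma iter_mirror (g : R -> R) (n : nat) (x : R) :
  iter (mirror g) n x = 1 - iter g n (1 - x).
Proof.
  induction n as [|n IH]; [unfold iter; simpl; ring|].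
  rewrite !iter_S, IH. unfold mirror. do 2 f_equal. ring.
Qed.

Lemma mirror_interval_map (g : R -> R) : interval_map g -> interval_map (mirror g).
Proof.
  intros [Hc Hm]; split.
  - apply (continuity_minus (fun _ => 1) (fun x => g (1 - x))).
    { apply continuity_const; intros s t; reflexivity. }
    apply (continuity_comp (fun x => 1 - x) g); [|exact Hc].
    apply (continuity_minus (fun _ => 1) (fun x => x)).
    { apply continuity_const; intros s t; reflexivity. }
    apply derivable_continuous, derivable_id.
  - intros x Hx. unfold mirror, I01 in *. specialize (Hm (1 - x)). lra.
Qed.

Lemma covers_mirror (g : R -> R) (a b c d : R) : covers (mirror g) a b c d ->
  covers g (1 - b) (1 - a) (1 - d) (1 - c).
Proof.
  unfold mirror. intros [[u [Hu Hu']] [v [Hv Hv']]].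
  split; [exists (1 - v)|exists (1 - u)]; lra.
Qed.

Lemma tame_mirror (g : R -> R) : tame g -> tame (mirror g).
Proof.
  intros H m Hm Hh. apply (H m Hm).
  apply (horseshoe_ext (iter (mirror g) m) (mirror (iter g m))) in Hh;
    [|intros x _; apply iter_mirror].
  destruct Hh as (l & r & a & b & c & d & H1 & H2 & H3 & H4 & H5 & H6 & H7 & H8).
  exists (1 - r), (1 - l), (1 - d), (1 - c), (1 - b), (1 - a).
  repeat (split; [lra|]). split; now apply covers_mirror.
Qed.

(** * Orbits near a fixed point of a tame map *)

(** As $g(z)=z$ and $g(c)>c$, the interval $[z,c]$ contains a preimage of $c$, again strictly
    between $z$ and $c$; this is repeated $n$ times from $t$. *)
Lemma backward_orbit (g : R -> R) (z u t : R) (n : nat) : interval_map g ->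
  g z = z -> (forall s, z < s <= u -> s < g s) -> z < t <= u ->
  exists c, z < c <= t /\ iter g n c = t /\ ((1 <= n)%nat -> c < t).
Proof.
  intros [Hg _] Hz Hup Ht; induction n as [|n [c [Hc [E _]]]].
  - exists t; repeat split; try lra; lia.
  - assert (c < g c) by (apply Hup; lra).
    destruct (ivt g z c z c c Hg) as [d [Hd Ed]]; [lra..|].
    assert (d <> z) by (intros ->; lra). assert (d <> c) by (intros ->; lra).
    exists d; repeat split; try lra. now rewrite iter_S_r, Ed.
Qed.

(** Let $z<c<t$ with $g^n(c)=t$. If $g^n(t)=z$, then $g^n$ sends $z,c,t$ to $z,t,z$, so that $[z,c]$
    and $[c,t]$ both cover $[z,t]$. *)
Lemma no_homoclinic (g : R -> R) (z u t : R) (n : nat) : interval_map g -> tame g ->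
  0 <= z -> u <= 1 -> g z = z -> (forall s, z < s <= u -> s < g s) -> z < t <= u ->
  iter g n t <> z.
Proof.
  intros Hg Htame Hz0 Hu1 Hz Hup Ht E.
  destruct n as [|n]; [unfold iter in E; simpl in E; lra|].
  destruct (backward_orbit g z u t (S n) Hg Hz Hup Ht) as [c [Hc [Ec Hlt]]].
  specialize (Hlt ltac:(lia)). apply (Htame (S n)); [lia|].
  assert (Fz := iter_fix g (S n) z Hz).
  exists z, t, z, c, c, t. repeat (split; [lra|]).
  split; split; [exists z|exists c|exists t|exists c]; lra.
Qed.

(** Otherwise $g^n$ takes a value at most $z$ at $t$ and the value $t>z$ at some $c\le t$, hence the
    value $z$ in between, against [no_homoclinic]. *)
Lemma stay_above (g : R -> R) (z u t : R) (n : nat) : interval_map g -> tame g ->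
  0 <= z -> u <= 1 -> g z = z -> (forall s, z < s <= u -> s < g s) -> z < t <= u ->
  z < iter g n t.
Proof.
  intros Hg Htame Hz0 Hu1 Hz Hup Ht. apply Rnot_le_lt; intros Hle.
  destruct (backward_orbit g z u t n Hg Hz Hup Ht) as [c [Hc [Ec _]]].
  destruct (ivt (iter g n) c t t c z) as [x [Hx E]]; [|lra..|].
  { now apply iter_continuity, Hg. }
  refine (no_homoclinic g z u x n Hg Htame Hz0 Hu1 Hz Hup _ E). lra.
Qed.

Definition clusters (g : R -> R) (x z : R) : Prop :=
  forall eta, eta > 0 -> forall N : nat,
    exists n, (N <= n)%nat /\ Rabs (iter g n x - z) < eta.

Definition converges (g : R -> R) (x z : R) : Prop :=
  forall eta, eta > 0 -> exists N : nat,
    forall n, (N <= n)%nat -> Rabs (iter g n x - z) < eta.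

Lemma small_inverse (eta : R) : eta > 0 -> exists N : nat,
  forall n, (N <= n)%nat -> / INR (S n) < eta.
Proof.
  intros He. destruct (archimed_cor1 eta He) as [N [HN HN0]].
  exists N; intros n Hn. apply Rle_lt_trans with (/ INR N); [|exact HN].
  apply Rinv_le_contravar; [now apply lt_0_INR|apply le_INR; lia].
Qed.

Lemma cluster_point (s : nat -> R) : (forall n, I01 (s n)) -> exists w, I01 w /\
  forall eta, eta > 0 -> forall N : nat, exists n, (N <= n)%nat /\ Rabs (s n - w) < eta.
Proof.
  intros Hs.
  destruct (Bolzano_Weierstrass s (fun c => 0 <= c <= 1) (compact_P3 0 1) Hs) as [w Hw].
  assert (Hcl : forall eta, eta > 0 -> forall N : nat,
    exists n, (N <= n)%nat /\ Rabs (s n - w) < eta).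
  { intros eta He N.
    destruct (Hw (disc w (mkposreal eta He)) N) as [n [Hn Hd]]; [|now exists n].
    exists (mkposreal eta He). intros y Hy; exact Hy. }
  exists w; split; [|exact Hcl].
  unfold I01 in *. split; apply Rnot_lt_le; intros Hlt.
  - destruct (Hcl (- w) ltac:(lra) 0%nat) as [n [_ Hn]].
    specialize (Hs n); apply Rabs_def2 in Hn; lra.
  - destruct (Hcl (w - 1) ltac:(lra) 0%nat) as [n [_ Hn]].
    specialize (Hs n); apply Rabs_def2 in Hn; lra.
Qed.

(** If the orbit came arbitrarily close to $z$, a limit would give $w'\mapsto w\mapsto z$ with $w\ge
    u$. It then remains to show that some point of $(z,u]$ reaches $w$, and hence $z$, which
    [no_homoclinic] excludes. *)
Lemma stay_away (g : R -> R) (z u t : R) : interval_map g -> tame g ->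
  0 <= z -> u <= 1 -> g z = z -> (forall s, z < s <= u -> s < g s) -> z < t <= u ->
  exists delta, delta > 0 /\ forall n, z + delta <= iter g n t.
Proof.
  intros Hg Htame Hz0 Hu1 Hz Hup Ht.
  assert (Habove : forall n, z < iter g n t)
    by (intros n; now apply (stay_above g z u)).
  assert (HI : forall n, I01 (iter g n t))
    by (intros n; apply iter_I01; [exact Hg|unfold I01; lra]).
  apply NNPP; intros Hno.
  (* A closest visit to [z] enters [(z, u]] from beyond [u]. *)
  assert (Hentry : forall j : nat, exists k, iter g (S (S k)) t < z + / INR (S j) /\
    u < iter g (S k) t).
  { intros j. assert (Hj : 0 < / INR (S j)) by (apply Rinv_0_lt_compat, lt_0_INR; lia).
    (* The terms [t - z] and [iter g 1 t - z] rule out times 0 and 1, so the first visit below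
       [z + d] happens at a time of the form [S (S k)]. *)
    set (d := Rmin (/ INR (S j)) (Rmin (u - z) (Rmin (t - z) (iter g 1 t - z)))).
    assert (Hd : d > 0).
    { specialize (Habove 1%nat). unfold d. repeat apply Rmin_glb_lt; lra. }
    assert (d <= / INR (S j) /\ d <= u - z /\ d <= t - z /\ d <= iter g 1 t - z)
      as (Hd1 & Hd2 & Hd3 & Hd4).
    { unfold d; repeat split; eauto using Rmin_l, Rmin_r, Rle_trans. }
    assert (Hex : exists n, iter g n t < z + d).
    { apply NNPP; intros Hn; apply Hno. exists d; split; [exact Hd|].
      intros n; apply Rnot_lt_le; intros Hlt; apply Hn; now exists n. }
    destruct (dec_inh_nat_subset_has_unique_least_element
      (fun n => iter g n t < z + d)) as [k [[Hk Hmin] _]];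
      [intros n; apply classic|exact Hex|].
    destruct k as [|[|k]].
    - unfold iter in Hk; simpl in Hk; lra.
    - lra.
    - exists k; split; [lra|]. apply Rnot_le_lt; intros Hle.
      assert (z + d <= iter g (S k) t).
      { apply Rnot_lt_le; intros Hlt. apply Hmin in Hlt. lia. }
      assert (iter g (S k) t < g (iter g (S k) t)) by (apply Hup; split; [apply Habove|exact Hle]).
      rewrite iter_S in Hk. lra. }
  set (k := fun j => proj1_sig (constructive_indefinite_description _ (Hentry j))).
  assert (Hk : forall j, iter g (S (S (k j))) t < z + / INR (S j) /\ u < iter g (S (k j)) t).
  { intros j; exact (proj2_sig (constructive_indefinite_description _ (Hentry j))). }
  clearbody k.
  (* [w'] is a limit of the orbit points two steps before the close visits: its image lies at or
     beyond [u], and its second image is [z]. *)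
  destruct (cluster_point (fun j => iter g (k j) t)) as [w' [Hw'I Hw']];
    [intros j; apply HI|].
  destruct Hg as [Hc Hm].
  assert (Hw1 : u <= g w').
  { apply Rnot_lt_le; intros Hlt.
    destruct (continuity_eps g w' (u - g w') Hc) as [d [Hd H]]; [lra|].
    destruct (Hw' d Hd 0%nat) as [j [_ Hj]]. apply H, Rabs_def2 in Hj.
    destruct (Hk j) as [_ Hkj]. rewrite iter_S in Hkj. lra. }
  assert (Hw2 : g (g w') = z).
  { apply NNPP; intros Hne.
    set (e := Rabs (g (g w') - z) / 2).
    assert (He : e > 0)
      by (assert (0 < Rabs (g (g w') - z)) by (apply Rabs_pos_lt; lra); unfold e; lra).
    destruct (continuity_eps (iter g 2) w' e (iter_continuity g 2 Hc) He) as [d [Hd H]].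
    destruct (small_inverse e He) as [N HN].
    destruct (Hw' d Hd N) as [j [Hj Hjd]]. apply H in Hjd.
    rewrite <- iter_add in Hjd. change (2 + k j)%nat with (S (S (k j))) in Hjd.
    change (iter g 2 w') with (g (g w')) in Hjd.
    specialize (HN j Hj). destruct (Hk j) as [Hkj _].
    specialize (Habove (S (S (k j)))).
    assert (Rabs (g (g w') - z) < 2 * e); [|unfold e in *; lra].
    apply Rabs_def2 in Hjd. apply Rabs_def1; lra. }
  set (w := g w') in *.
  assert (Hwz : w <> z) by lra.
  assert (Hreach : forall n y, z <= y <= iter g n t -> y <> z ->
    exists s, z < s <= u /\ iter g n s = y).
  { intros n y Hy Hyz.
    destruct (ivt (iter g n) z t z t y) as [s [Hs E]]; [|lra|lra| |].
    { now apply iter_continuity. }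
    { now rewrite iter_fix. }
    assert (s <> z) by (intros ->; rewrite iter_fix in E; congruence).
    exists s; split; [lra|exact E]. }
  assert (Hbad : forall n s, z < s <= u -> iter g n s <> w).
  { intros n s Hs E.
    refine (no_homoclinic g z u s (S n) _ Htame Hz0 Hu1 Hz Hup Hs _); [now split|].
    now rewrite iter_S, E. }
  (* If the orbit passes [w], then [w] is reached from $(z,u]$. If not, then $z<w'<w$, and the orbit
     comes close enough to [w] to pass [w']; so [w'], and one step later [w], is reached. *)
  destruct (classic (exists n, w <= iter g n t)) as [[n Hn]|Htop].
  { destruct (Hreach n w) as [s [Hs E]]; [lra|lra|]. exact (Hbad n s Hs E). }
  assert (Htop' : forall n, iter g n t < w).
  { intros n; apply Rnot_le_lt; intros Hle; apply Htop; now exists n. }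
  assert (Hw'w : w' < w).
  { assert (w' <= w).
    { apply Rnot_lt_le; intros Hlt.
      destruct (Hw' (w' - w) ltac:(lra) 0%nat) as [j [_ Hj]]. apply Rabs_def2 in Hj.
      specialize (Htop' (k j)). lra. }
    assert (w' <> w) by (intros E; unfold w in *; rewrite E in *; congruence). lra. }
  assert (Hw'z : z < w').
  { assert (z <= w').
    { apply Rnot_lt_le; intros Hlt.
      destruct (Hw' (z - w') ltac:(lra) 0%nat) as [j [_ Hj]]. apply Rabs_def2 in Hj.
      specialize (Habove (k j)). lra. }
    assert (w' <> z) by (intros E; unfold w in *; rewrite E in *; congruence). lra. }
  destruct (continuity_eps g w' (w - w') Hc) as [d [Hd H]]; [lra|].
  destruct (Hw' d Hd 0%nat) as [j [_ Hj]]. apply H, Rabs_def2 in Hj.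
  fold w in Hj.
  destruct (Hreach (S (k j)) w') as [s [Hs E]]; [rewrite iter_S; lra|lra|].
  apply (Hbad (S (S (k j))) s Hs). now rewrite iter_S, E.
Qed.

(** For $z$ the last fixed point before $p$, all points of $(z,p]$ move up, and [stay_away]
    applies. *)
Lemma up_stays_away (g : R -> R) (q p : R) : interval_map g -> tame g ->
  0 <= q -> p <= 1 -> q < p -> g q <= q -> p < g p ->
  exists z delta, q <= z < p /\ g z = z /\ delta > 0 /\ forall n, z + delta <= iter g n p.
Proof.
  intros Hg Htame Hq Hp Hqp Hdown Hup.
  destruct (last_point (fun s => g s - s) q p 0) as [z [Hz [E H]]]; [|lra|lra|].
  { apply (continuity_minus g (fun s => s)); [apply Hg|].
    apply derivable_continuous, derivable_id. }
  destruct (stay_away g z p p Hg Htame) as [d [Hd Hd']]; [lra|lra|lra| |lra|].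
  - intros s Hs; specialize (H s Hs); lra.
  - exists z, d; repeat split; try assumption; lra.
Qed.

Lemma down_stays_away (g : R -> R) (q p : R) : interval_map g -> tame g ->
  0 <= q -> p <= 1 -> q < p -> g q < q -> p <= g p ->
  exists z delta, q < z <= p /\ g z = z /\ delta > 0 /\ forall n, iter g n q <= z - delta.
Proof.
  intros Hg Htame Hq Hp Hqp Hdown Hup.
  destruct (up_stays_away (mirror g) (1 - p) (1 - q)) as [z [d [Hz [E [Hd H]]]]];
    [now apply mirror_interval_map|now apply tame_mirror|lra|lra|lra| | |].
  1, 2: unfold mirror; replace (1 - (1 - p)) with p by ring;
    replace (1 - (1 - q)) with q by ring; lra.
  exists (1 - z), d; unfold mirror in E; repeat split; try lra.
  intros n; specialize (H n). rewrite iter_mirror in H.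
  replace (1 - (1 - q)) with q in H by ring. lra.
Qed.

(** Otherwise a fixed point $z$ separates the two points: the upper orbit stays above $z+\delta$,
    while the lower one stays below a fixed point $z'\le z$. Proximality fails. *)
Lemma proximal_up_le_down (g : R -> R) (x y : R) (i j : nat) : interval_map g -> tame g ->
  I01 x -> I01 y -> Prox g x y -> iter g i x < iter g (S i) x ->
  iter g (S j) y < iter g j y -> iter g i x <= iter g j y.
Proof.
  intros Hg Htame Hx Hy Hprox Hup Hdown.
  rewrite iter_S in Hup, Hdown. apply Rnot_lt_le; intros Hlt.
  assert (HI := iter_I01 g i x Hg Hx). assert (HJ := iter_I01 g j y Hg Hy).
  unfold I01 in HI, HJ.
  destruct (up_stays_away g (iter g j y) (iter g i x)) as [z [d [Hz [Ez [Hd H]]]]];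
    try assumption; try lra.
  assert (iter g j y <> z) by (intros E; rewrite E in Hdown; lra).
  destruct (down_stays_away g (iter g j y) z) as [z' [d' [Hz' [Ez' [Hd' H']]]]];
    try assumption; try lra.
  destruct (Hprox d Hd (i + j)%nat) as [n [Hn Hn']]. unfold odist in Hn'.
  specialize (H (n - i)%nat); specialize (H' (n - j)%nat).
  rewrite <- iter_add in H, H'.
  replace (n - i + i)%nat with n in H by lia. replace (n - j + j)%nat with n in H' by lia.
  apply Rabs_def2 in Hn'. lra.
Qed.

(** * Orbits that cluster at a fixed point *)

Lemma clusters_tail (g : R -> R) (i : nat) (x z : R) :
  clusters g x z -> clusters g (iter g i x) z.
Proof.
  intros H eta He N. destruct (H eta He (N + i)%nat) as [n [Hn Hn']].
  exists (n - i)%nat; split; [lia|].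
  rewrite <- iter_add. now replace (n - i + i)%nat with n by lia.
Qed.

(** A point at or above $z$ that moves up is kept at a positive distance above a fixed point that is
    at least $z$, so its orbit cannot cluster at $z$. *)
Lemma clusters_up (g : R -> R) (x z : R) : interval_map g -> tame g -> I01 x -> I01 z ->
  g z = z -> clusters g x z -> x < g x -> x < z.
Proof.
  intros Hg Htame Hx Hz Ez Hacc Hup. unfold I01 in *.
  assert (Hxz : x <> z) by (intros ->; lra). apply Rnot_le_lt; intros Hle.
  destruct (up_stays_away g z x) as [z1 [d [Hz1 [_ [Hd H]]]]]; try assumption; try lra.
  destruct (Hacc d Hd 0%nat) as [n [_ Hn]]. specialize (H n). apply Rabs_def2 in Hn. lra.
Qed.

Lemma clusters_down (g : R -> R) (x z : R) : interval_map g -> tame g -> I01 x -> I01 z ->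
  g z = z -> clusters g x z -> g x < x -> z < x.
Proof.
  intros Hg Htame Hx Hz Ez Hacc Hdown. unfold I01 in *.
  assert (Hxz : x <> z) by (intros ->; lra). apply Rnot_le_lt; intros Hle.
  destruct (down_stays_away g x z) as [z1 [d [Hz1 [_ [Hd H]]]]]; try assumption; try lra.
  destruct (Hacc d Hd 0%nat) as [n [_ Hn]]. specialize (H n). apply Rabs_def2 in Hn. lra.
Qed.

Lemma iterates_equicontinuous (g : R -> R) (z eta : R) (M : nat) : continuity g -> eta > 0 ->
  exists delta, delta > 0 /\ forall r s, (r < M)%nat -> Rabs (s - z) < delta ->
    Rabs (iter g r s - iter g r z) < eta.
Proof.
  intros Hg He; induction M as [|M [d [Hd H]]].
  - exists 1; split; [lra|]. intros; lia.
  - destruct (continuity_eps (iter g M) z eta (iter_continuity g M Hg) He) as [d' [Hd' H']].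
    exists (Rmin d d'); split; [now apply Rmin_glb_lt|].
    intros r s Hr Hs.
    assert (Rabs (s - z) < d) by (eapply Rlt_le_trans; [exact Hs|apply Rmin_l]).
    assert (Rabs (s - z) < d') by (eapply Rlt_le_trans; [exact Hs|apply Rmin_r]).
    destruct (Nat.eq_dec r M) as [->|]; [now apply H'|]. apply H; [lia|assumption].
Qed.

Lemma next_multiple (M k : nat) : (1 <= M)%nat ->
  exists r n, (r < M /\ n * M = r + k)%nat.
Proof.
  intros HM. assert (E := Nat.div_mod_eq k M).
  assert (Hlt := Nat.mod_upper_bound k M ltac:(lia)).
  destruct (Nat.eq_dec (k mod M) 0) as [E0|Hne].
  - exists 0%nat, (k / M)%nat; split; nia.
  - exists (M - k mod M)%nat, (S (k / M)); split; nia.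
Qed.

(** The next multiple of $M$ after a close visit comes fewer than $M$ steps later, and by continuity
    the fixed point $z$ holds the orbit close for that long. *)
Lemma clusters_iter (g : R -> R) (M : nat) (x z : R) : interval_map g -> (1 <= M)%nat ->
  g z = z -> clusters g x z -> clusters (iter g M) x z.
Proof.
  intros [Hg _] HM Hz Hacc eta He N.
  destruct (iterates_equicontinuous g z eta M Hg He) as [d [Hd H]].
  destruct (Hacc d Hd (N * M)%nat) as [k [Hk Hk']].
  destruct (next_multiple M k HM) as [r [n [Hr Hn]]].
  exists n; split; [nia|].
  rewrite iter_mul, Hn, iter_add, <- (iter_fix g r z Hz). now apply H.
Qed.

(* By the preceding lemmas applied to every power of [g], an orbit that
   clusters at [z] never moves away from it again on either side. *)
Lemma clusters_converges (g : R -> R) (x z : R) : interval_map g -> tame g ->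
  I01 x -> I01 z -> g z = z -> clusters g x z -> converges g x z.
Proof.
  intros Hg Htame Hx Hz Ez Hacc.
  assert (Hmono : forall i j, (i <= j)%nat ->
    (iter g i x < z -> iter g i x <= iter g j x) /\
    (z < iter g i x -> iter g j x <= iter g i x) /\
    (iter g i x = z -> iter g j x = z)).
  { intros i j Hij.
    destruct (Nat.eq_dec i j) as [->|Hne]; [repeat split; intros; lra|].
    assert (Ej : iter g j x = iter g (j - i) (iter g i x))
      by (rewrite <- iter_add; now replace (j - i + i)%nat with j by lia).
    assert (HI := iter_I01 g i x Hg Hx).
    assert (Hgj := interval_map_iter g (j - i) Hg).
    assert (Htj : tame (iter g (j - i))) by (apply tame_iter; [lia|assumption]).
    assert (Haj : clusters (iter g (j - i)) (iter g i x) z)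
      by (apply clusters_iter; [assumption|lia|assumption|now apply clusters_tail]).
    assert (Fz := iter_fix g (j - i) z Ez).
    rewrite Ej. repeat split.
    - intros Hlt. apply Rnot_lt_le; intros Hd.
      assert (z < iter g i x) by now apply (clusters_down (iter g (j - i))). lra.
    - intros Hlt. apply Rnot_lt_le; intros Hd.
      assert (iter g i x < z) by now apply (clusters_up (iter g (j - i))). lra.
    - now intros ->. }
  assert (Hlow : forall i j, (i <= j)%nat -> iter g i x < z -> iter g i x <= iter g j x)
    by (intros i j Hij; apply (Hmono i j Hij)).
  assert (Hhigh : forall i j, (i <= j)%nat -> z < iter g i x -> iter g j x <= iter g i x)
    by (intros i j Hij; apply (Hmono i j Hij)).
  intros eta He.
  destruct (continuity_eps g z eta (proj1 Hg) He) as [d [Hd H]].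
  destruct (Hacc (Rmin d eta) ltac:(now apply Rmin_glb_lt) 0%nat) as [i [_ Hi]].
  assert (Hid : Rabs (iter g i x - z) < d) by (eapply Rlt_le_trans; [exact Hi|apply Rmin_l]).
  assert (Hie : Rabs (iter g i x - z) < eta) by (eapply Rlt_le_trans; [exact Hi|apply Rmin_r]).
  apply Rabs_def2 in Hid, Hie.
  destruct (Rtotal_order (iter g i x) z) as [Hlt|[Heq|Hgt]].
  (* Until its first crossing of [z] the orbit lies between [iter g i x] and [z], hence within [d]
     of [z]; so the crossing lands within [eta]. From then on the orbit is trapped from both
     sides. *)
  - destruct (classic (exists n, (i <= n)%nat /\ z < iter g n x)) as [Hex|Hnone].
    + destruct (dec_inh_nat_subset_has_unique_least_element
        (fun n => (i <= n)%nat /\ z < iter g n x)) as [k [[[Hk Hk'] Hmin] _]];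
        [intros n; apply classic|exact Hex|].
      destruct k as [|k]; [assert (i = 0%nat) by lia; subst; lra|].
      assert (Hik : (i <= k)%nat) by (destruct (Nat.eq_dec i (S k)) as [->|]; [lra|lia]).
      assert (iter g k x <= z).
      { apply Rnot_lt_le; intros Hz'. specialize (Hmin k (conj Hik Hz')). lia. }
      assert (iter g i x <= iter g k x) by now apply Hlow.
      assert (Hk2 : Rabs (g (iter g k x) - g z) < eta) by (apply H, Rabs_def1; lra).
      rewrite Ez in Hk2. change (g (iter g k x)) with (iter g (S k) x) in Hk2.
      apply Rabs_def2 in Hk2.
      exists (S k); intros n Hn.
      assert (iter g n x <= iter g (S k) x) by now apply Hhigh.
      assert (iter g i x <= iter g n x) by (apply Hlow; [lia|assumption]).
      apply Rabs_def1; lra.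
    + exists i; intros n Hn.
      assert (iter g n x <= z)
        by (apply Rnot_lt_le; intros Hn'; apply Hnone; now exists n).
      assert (iter g i x <= iter g n x) by now apply Hlow.
      apply Rabs_def1; lra.
  - exists i; intros n Hn.
    assert (iter g n x = z) as -> by now apply (Hmono i).
    rewrite Rminus_diag, Rabs_R0; lra.
  - destruct (classic (exists n, (i <= n)%nat /\ iter g n x < z)) as [Hex|Hnone].
    + destruct (dec_inh_nat_subset_has_unique_least_element
        (fun n => (i <= n)%nat /\ iter g n x < z)) as [k [[[Hk Hk'] Hmin] _]];
        [intros n; apply classic|exact Hex|].
      destruct k as [|k]; [assert (i = 0%nat) by lia; subst; lra|].
      assert (Hik : (i <= k)%nat) by (destruct (Nat.eq_dec i (S k)) as [->|]; [lra|lia]).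
      assert (z <= iter g k x).
      { apply Rnot_lt_le; intros Hz'. specialize (Hmin k (conj Hik Hz')). lia. }
      assert (iter g k x <= iter g i x) by now apply Hhigh.
      assert (Hk2 : Rabs (g (iter g k x) - g z) < eta) by (apply H, Rabs_def1; lra).
      rewrite Ez in Hk2. change (g (iter g k x)) with (iter g (S k) x) in Hk2.
      apply Rabs_def2 in Hk2.
      exists (S k); intros n Hn.
      assert (iter g (S k) x <= iter g n x) by now apply Hlow.
      assert (iter g n x <= iter g i x) by (apply Hhigh; [lia|assumption]).
      apply Rabs_def1; lra.
    + exists i; intros n Hn.
      assert (z <= iter g n x)
        by (apply Rnot_lt_le; intros Hn'; apply Hnone; now exists n).
      assert (iter g n x <= iter g i x) by now apply Hhigh.
      apply Rabs_def1; lra.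
Qed.

(** * Alternation around a fixed point *)

(** Stronger than not being periodic: the $\omega$-limit set of $x$ contains no periodic point. *)
Definition aperiodic (g : R -> R) (x : R) : Prop :=
  forall (M : nat) (w : R), (1 <= M)%nat -> I01 w -> iter g M w = w -> ~ clusters g x w.

Definition in_closure (g : R -> R) (x y : R) : Prop :=
  forall eta, eta > 0 -> exists n, Rabs (iter g n x - y) < eta.

Lemma closure_I01 (g : R -> R) (x y : R) : interval_map g -> I01 x ->
  in_closure g x y -> I01 y.
Proof.
  intros Hg Hx H. assert (HI := fun n => iter_I01 g n x Hg Hx). unfold I01 in *.
  split; apply Rnot_lt_le; intros Hlt.
  - destruct (H (- y)) as [n Hn]; [lra|]. specialize (HI n). apply Rabs_def2 in Hn. lra.
  - destruct (H (y - 1)) as [n Hn]; [lra|]. specialize (HI n). apply Rabs_def2 in Hn. lra.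
Qed.

Lemma closure_step (g : R -> R) (x y : R) : continuity g ->
  in_closure g x y -> in_closure g x (g y).
Proof.
  intros Hg H eta He. destruct (continuity_eps g y eta Hg He) as [d [Hd Hc]].
  destruct (H d Hd) as [n Hn]. exists (S n). now apply Hc.
Qed.

Lemma orbit_in_closure (g : R -> R) (x : R) (n : nat) : in_closure g x (iter g n x).
Proof. intros eta He; exists n. now rewrite Rminus_diag, Rabs_R0. Qed.

(** A periodic $y$ on the orbit would be visited again and again. A $y$ off the orbit has positive
    distance from each finite part of it, so that close visits must occur late. Either way the orbit
    clusters at $y$. *)
Lemma closure_aperiodic (g : R -> R) (x y : R) (M : nat) : interval_map g -> I01 x ->
  aperiodic g x -> in_closure g x y -> (1 <= M)%nat -> iter g M y <> y.
Proof.
  intros Hg Hx Hap Hcl HM HP.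
  apply (Hap M y HM); [now apply (closure_I01 g x)|exact HP|].
  destruct (classic (exists n, iter g n x = y)) as [[n Hn]|Hnone].
  - intros eta He N. exists (N * M + n)%nat; split; [nia|].
    rewrite iter_add, Hn, <- iter_mul, (iter_fix (iter g M) N y HP).
    now rewrite Rminus_diag, Rabs_R0.
  - assert (Hfin : forall N, exists e, e > 0 /\
      forall n, (n < N)%nat -> e <= Rabs (iter g n x - y)).
    { induction N as [|N [e [He H]]]; [exists 1; split; [lra|intros; lia]|].
      assert (0 < Rabs (iter g N x - y)).
      { apply Rabs_pos_lt. intros E; apply Hnone; exists N; lra. }
      exists (Rmin e (Rabs (iter g N x - y))); split; [now apply Rmin_glb_lt|].
      intros n Hn. destruct (Nat.eq_dec n N) as [->|Hne]; [apply Rmin_r|].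
      eapply Rle_trans; [apply Rmin_l|apply H; lia]. }
    intros eta He N. destruct (Hfin N) as [e [Hep H]].
    destruct (Hcl (Rmin e eta)) as [n Hn]; [now apply Rmin_glb_lt|].
    exists n; split; [|eapply Rlt_le_trans; [exact Hn|apply Rmin_r]].
    apply Nat.nlt_ge; intros Hlt. specialize (H n Hlt).
    assert (Rabs (iter g n x - y) < e) by (eapply Rlt_le_trans; [exact Hn|apply Rmin_l]).
    lra.
Qed.

Lemma orbit_aperiodic (g : R -> R) (x : R) (n : nat) : interval_map g -> I01 x ->
  aperiodic g x -> g (iter g n x) <> iter g n x.
Proof.
  intros Hg Hx Hap.
  apply (closure_aperiodic g x (iter g n x) 1); auto using orbit_in_closure.
Qed.

(** A monotone orbit converges to its supremum, which is fixed by continuity. *)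
Lemma increasing_clusters (g : R -> R) (x : R) : interval_map g -> I01 x ->
  (forall n, iter g n x <= iter g (S n) x) ->
  exists w, I01 w /\ g w = w /\ clusters g x w.
Proof.
  intros Hg Hx Hinc. assert (HI := fun n => iter_I01 g n x Hg Hx).
  assert (Hmono : forall i j, (i <= j)%nat -> iter g i x <= iter g j x).
  { intros i j Hij; induction Hij as [|j Hij IH]; [lra|]. specialize (Hinc j); lra. }
  destruct (completeness (fun y => exists n, y = iter g n x)) as [w [Hub Hlub]].
  { exists 1. intros y [n ->]. apply HI. }
  { exists x, 0%nat. reflexivity. }
  assert (Hacc : forall eta, eta > 0 -> exists N, forall n, (N <= n)%nat ->
    w - eta < iter g n x <= w).
  { intros eta He.
    destruct (classic (exists N, w - eta < iter g N x)) as [[N HN]|Hnone].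
    - exists N; intros n Hn. specialize (Hmono N n Hn).
      assert (iter g n x <= w) by (apply Hub; now exists n). lra.
    - assert (w <= w - eta); [|lra].
      apply Hlub; intros y [n ->]. apply Rnot_lt_le; intros Hlt; apply Hnone; now exists n. }
  assert (HA : clusters g x w).
  { intros eta He N. destruct (Hacc eta He) as [N' HN']. exists (N + N')%nat; split; [lia|].
    specialize (HN' (N + N')%nat ltac:(lia)). apply Rabs_def1; lra. }
  exists w; split; [|split; [|exact HA]].
  - apply (closure_I01 g x w Hg Hx). intros eta He.
    destruct (HA eta He 0%nat) as [n [_ Hn]]; now exists n.
  - apply NNPP; intros Hne.
    assert (Hp : 0 < Rabs (g w - w)) by (apply Rabs_pos_lt; lra).
    destruct (continuity_eps g w (Rabs (g w - w) / 2) (proj1 Hg)) as [d [Hd H]]; [lra|].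
    set (e := Rmin d (Rabs (g w - w) / 2)).
    assert (He : e > 0) by (apply Rmin_glb_lt; lra).
    destruct (Hacc e He) as [N HN].
    assert (H1 := HN N ltac:(lia)). assert (H2 := HN (S N) ltac:(lia)).
    assert (e <= d) by apply Rmin_l. assert (e <= Rabs (g w - w) / 2) by apply Rmin_r.
    assert (Hnear : Rabs (g (iter g N x) - g w) < Rabs (g w - w) / 2)
      by (apply H, Rabs_def1; lra).
    rewrite <- iter_S in Hnear. apply Rabs_def2 in Hnear.
    assert (Rabs (g w - w) < Rabs (g w - w)); [|lra].
    apply Rabs_def1; lra.
Qed.

Lemma clusters_mirror (g : R -> R) (x z : R) :
  clusters (mirror g) x z -> clusters g (1 - x) (1 - z).
Proof.
  intros H eta He N. destruct (H eta He N) as [n [Hn Hn']].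
  exists n; split; [exact Hn|]. rewrite iter_mirror in Hn'.
  rewrite Rabs_minus_sym in Hn'.
  now replace (iter g n (1 - x) - (1 - z)) with (z - (1 - iter g n (1 - x))) by ring.
Qed.

Lemma aperiodic_goes_down (g : R -> R) (x : R) : interval_map g -> I01 x ->
  aperiodic g x -> exists n, iter g (S n) x < iter g n x.
Proof.
  intros Hg Hx Hap. apply NNPP; intros Hnone.
  destruct (increasing_clusters g x Hg Hx) as [w [Hw [Ew Hacc]]].
  - intros n; apply Rnot_lt_le; intros Hlt; apply Hnone; now exists n.
  - now apply (Hap 1%nat w).
Qed.

Lemma aperiodic_goes_up (g : R -> R) (x : R) : interval_map g -> I01 x ->
  aperiodic g x -> exists n, iter g n x < iter g (S n) x.
Proof.
  intros Hg Hx Hap. apply NNPP; intros Hnone.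
  destruct (increasing_clusters (mirror g) (1 - x)) as [w [Hw [Ew Hacc]]].
  - now apply mirror_interval_map.
  - unfold I01 in *; lra.
  - intros n. rewrite !iter_mirror. replace (1 - (1 - x)) with x by ring.
    apply Rnot_lt_le; intros Hlt; apply Hnone; exists n; lra.
  - apply clusters_mirror in Hacc. replace (1 - (1 - x)) with x in Hacc by ring.
    apply (Hap 1%nat (1 - w)); [lia|unfold I01 in *; lra| |exact Hacc].
    unfold mirror in Ew. unfold iter; simpl; lra.
Qed.

(* Besides covering itself, [[a, b]] covers [[e, a]] after [N] steps,
   and [[e, a]] covers [[a, b]]: two different loops of length [N + 1]. *)
Lemma no_escape_left (g : R -> R) (a b e s : R) (N : nat) : interval_map g -> tame g ->
  0 <= a -> a < b -> b <= 1 -> b <= g a -> g b <= a -> a <= s <= b -> iter g N s = e ->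
  e < a -> g e <= a -> False.
Proof.
  intros [Hg Hm] Htame Ha Hab Hb Hga Hgb Hs Es Hea Hge.
  assert (Hself : covers g a b a b) by (split; [exists b|exists a]; lra).
  assert (HN := covers_self_iter g N a b Hg ltac:(lra) Hself).
  assert (HN' : covers (iter g N) a b e a).
  { split; [exists s; lra|]. destruct HN as [_ [v [Hv Hv']]]. exists v; lra. }
  assert (HgN := iter_continuity g N Hg).
  destruct (pullback _ _ _ _ _ HgN Hea HN') as (u1 & v1 & Hu1 & Huv1 & Hv1 & C1 & _ & I1).
  destruct (pullback _ _ _ _ _ HgN Hab HN) as (u2 & v2 & Hu2 & Huv2 & Hv2 & C2 & _ & I2).
  apply (Htame (1 + N)%nat); [lia|].
  apply (apart_horseshoe _ a b u1 v1 u2 v2); try lra.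
  - apply (pullback_apart (iter g N) _ _ _ _ e a a b); try assumption.
    intros y Hy Hy'; lra.
  - apply (covers_iter_add g 1 N _ _ e a _ _ Hg C1).
    split; [exists e|exists a]; unfold iter; simpl; lra.
  - apply (covers_iter_add g 1 N _ _ a b _ _ Hg C2). exact Hself.
Qed.

Lemma no_escape_right (g : R -> R) (a b e s : R) (N : nat) : interval_map g -> tame g ->
  0 <= a -> a < b -> b <= 1 -> b <= g a -> g b <= a -> a <= s <= b -> iter g N s = e ->
  b < e -> b <= g e -> False.
Proof.
  intros Hg Htame Ha Hab Hb Hga Hgb Hs Es Hea Hge.
  apply (no_escape_left (mirror g) (1 - b) (1 - a) (1 - e) (1 - s) N); try lra.
  - now apply mirror_interval_map.
  - now apply tame_mirror.
  - unfold mirror; replace (1 - (1 - b)) with b by ring; lra.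
  - unfold mirror; replace (1 - (1 - a)) with a by ring; lra.
  - rewrite iter_mirror. replace (1 - (1 - s)) with s by ring. lra.
  - unfold mirror; replace (1 - (1 - e)) with e by ring; lra.
Qed.

(** Let $(a,b)$ be the gap of the orbit closure around $z$. Then $g(a)\ge b$ and $g(b)\le a$, and
    the orbit of some point of $[a,b]$ merges with that of $x$. After that time, two consecutive
    points on one side of $z$ would be an escape excluded by [no_escape_left] or
    [no_escape_right]. *)
Lemma alternation (g : R -> R) (x z : R) : interval_map g -> tame g -> I01 x ->
  g z = z -> aperiodic g x ->
  (forall n, iter g n x < z -> iter g n x < iter g (S n) x) ->
  (forall n, z < iter g n x -> iter g (S n) x < iter g n x) ->
  exists m, forall n, (m <= n)%nat ->
    ~ (iter g n x < z /\ iter g (S n) x < z) /\ ~ (z < iter g n x /\ z < iter g (S n) x).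
Proof.
  intros Hg Htame Hx Ez Hap Hleft Hright.
  assert (HI := fun n => iter_I01 g n x Hg Hx).
  assert (Hzcl : ~ in_closure g x z).
  { intros H. now apply (closure_aperiodic g x z 1 Hg Hx Hap H). }
  assert (Hz : forall n, iter g n x <> z).
  { intros n <-. apply Hzcl, orbit_in_closure. }
  destruct (aperiodic_goes_down g x Hg Hx Hap) as [nd Hnd].
  destruct (aperiodic_goes_up g x Hg Hx Hap) as [nu Hnu].
  assert (HL : iter g nu x < z).
  { destruct (Rtotal_order (iter g nu x) z) as [|[E|H]]; [assumption|now apply Hz in E|].
    apply Hright in H; lra. }
  assert (HR : z < iter g nd x).
  { destruct (Rtotal_order (iter g nd x) z) as [H|[E|]]; [|now apply Hz in E|assumption].
    apply Hleft in H; lra. }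
  destruct (completeness (fun y => exists n, y = iter g n x /\ y < z)) as [a [Haub Halub]].
  { exists z. intros y [n [_ Hy]]; lra. }
  { exists (iter g nu x), nu; now split. }
  (* The infimum [b] of the orbit points right of [z] is obtained as the negative of a supremum. *)
  destruct (completeness (fun y => exists n, - y = iter g n x /\ z < - y))
    as [b' [Hbub Hblub]].
  { exists (- z). intros y [n [_ Hy]]; lra. }
  { exists (- iter g nd x), nd; rewrite Ropp_involutive; now split. }
  set (b := - b').
  assert (HaL : forall n, iter g n x < z -> iter g n x <= a).
  { intros n Hn; apply Haub; now exists n. }
  assert (HbR : forall n, z < iter g n x -> b <= iter g n x).
  { intros n Hn. assert (- iter g n x <= b'); [|unfold b; lra].
    apply Hbub. exists n. rewrite Ropp_involutive; now split. }
  assert (Hanear : forall eta, eta > 0 -> exists n, a - eta < iter g n x <= a /\ iter g n x < z).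
  { intros eta He. apply NNPP; intros Hnone. assert (a <= a - eta); [|lra].
    apply Halub. intros y [n [-> Hy]]. apply Rnot_lt_le; intros Hlt.
    apply Hnone; exists n. specialize (HaL n Hy); lra. }
  assert (Hbnear : forall eta, eta > 0 -> exists n, b <= iter g n x < b + eta /\ z < iter g n x).
  { intros eta He. apply NNPP; intros Hnone. assert (b' <= b' - eta); [|lra].
    apply Hblub. intros y [n [Ey Hy]]. apply Rnot_lt_le; intros Hlt.
    apply Hnone; exists n. rewrite <- Ey. rewrite Ey in Hy. specialize (HbR n Hy).
    unfold b in *; lra. }
  assert (Hacl : in_closure g x a).
  { intros eta He. destruct (Hanear eta He) as [n [Hn _]]. exists n; apply Rabs_def1; lra. }
  assert (Hbcl : in_closure g x b).
  { intros eta He. destruct (Hbnear eta He) as [n [Hn _]]. exists n; apply Rabs_def1; lra. }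
  assert (HaI := closure_I01 g x a Hg Hx Hacl). assert (HbI := closure_I01 g x b Hg Hx Hbcl).
  destruct HaI as [Ha0 Ha1], HbI as [Hb0 Hb1].
  assert (Haz : a < z).
  { assert (a <= z) by (apply Halub; intros y [n [_ Hy]]; lra).
    assert (a <> z) by (intros ->; contradiction). lra. }
  assert (Hbz : z < b).
  { assert (b' <= - z) by (apply Hblub; intros y [n [_ Hy]]; lra).
    assert (b <> z) by (intros E; rewrite E in Hbcl; contradiction). unfold b in *; lra. }
  assert (Hc := proj1 Hg).
  assert (Hgacl := closure_step g x a Hc Hacl). assert (Hgbcl := closure_step g x b Hc Hbcl).
  (* [a] is a limit of points moving up and is not fixed, so $g(a)>a$; and [g a] lies in the orbit
     closure, which does not meet the gap. *)
  assert (Hga : b <= g a).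
  { assert (Hne := closure_aperiodic g x a 1 Hg Hx Hap Hacl ltac:(lia)).
    change (g a <> a) in Hne.
    assert (a <= g a).
    { apply Rnot_lt_le; intros Hlt.
      destruct (continuity_eps g a ((a - g a) / 2) Hc) as [d [Hd H]]; [lra|].
      destruct (Hanear (Rmin d ((a - g a) / 2))) as [n [Hn Hnz]]; [apply Rmin_glb_lt; lra|].
      assert (Rmin d ((a - g a) / 2) <= d) by apply Rmin_l.
      assert (Rmin d ((a - g a) / 2) <= (a - g a) / 2) by apply Rmin_r.
      assert (Hnear : Rabs (g (iter g n x) - g a) < (a - g a) / 2) by (apply H, Rabs_def1; lra).
      apply Rabs_def2 in Hnear. apply Hleft in Hnz. rewrite iter_S in Hnz. lra. }
    apply Rnot_lt_le; intros Hlt.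
    assert (g a <> z) by (intros E; rewrite E in Hgacl; contradiction).
    destruct (Rlt_dec (g a) z) as [Hgaz|Hgaz].
    - destruct (Hgacl (Rmin (g a - a) (z - g a))) as [n Hn]; [apply Rmin_glb_lt; lra|].
      assert (Rmin (g a - a) (z - g a) <= g a - a) by apply Rmin_l.
      assert (Rmin (g a - a) (z - g a) <= z - g a) by apply Rmin_r.
      apply Rabs_def2 in Hn. specialize (HaL n ltac:(lra)). lra.
    - destruct (Hgacl (Rmin (g a - z) (b - g a))) as [n Hn]; [apply Rmin_glb_lt; lra|].
      assert (Rmin (g a - z) (b - g a) <= g a - z) by apply Rmin_l.
      assert (Rmin (g a - z) (b - g a) <= b - g a) by apply Rmin_r.
      apply Rabs_def2 in Hn. specialize (HbR n ltac:(lra)). lra. }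
  assert (Hgb : g b <= a).
  { assert (Hne := closure_aperiodic g x b 1 Hg Hx Hap Hbcl ltac:(lia)).
    change (g b <> b) in Hne.
    assert (g b <= b).
    { apply Rnot_lt_le; intros Hlt.
      destruct (continuity_eps g b ((g b - b) / 2) Hc) as [d [Hd H]]; [lra|].
      destruct (Hbnear (Rmin d ((g b - b) / 2))) as [n [Hn Hnz]]; [apply Rmin_glb_lt; lra|].
      assert (Rmin d ((g b - b) / 2) <= d) by apply Rmin_l.
      assert (Rmin d ((g b - b) / 2) <= (g b - b) / 2) by apply Rmin_r.
      assert (Hnear : Rabs (g (iter g n x) - g b) < (g b - b) / 2) by (apply H, Rabs_def1; lra).
      apply Rabs_def2 in Hnear. apply Hright in Hnz. rewrite iter_S in Hnz. lra. }
    apply Rnot_lt_le; intros Hlt.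
    assert (g b <> z) by (intros E; rewrite E in Hgbcl; contradiction).
    destruct (Rlt_dec (g b) z) as [Hgbz|Hgbz].
    - destruct (Hgbcl (Rmin (g b - a) (z - g b))) as [n Hn]; [apply Rmin_glb_lt; lra|].
      assert (Rmin (g b - a) (z - g b) <= g b - a) by apply Rmin_l.
      assert (Rmin (g b - a) (z - g b) <= z - g b) by apply Rmin_r.
      apply Rabs_def2 in Hn. specialize (HaL n ltac:(lra)). lra.
    - destruct (Hgbcl (Rmin (g b - z) (b - g b))) as [n Hn]; [apply Rmin_glb_lt; lra|].
      assert (Rmin (g b - z) (b - g b) <= g b - z) by apply Rmin_l.
      assert (Rmin (g b - z) (b - g b) <= b - g b) by apply Rmin_r.
      apply Rabs_def2 in Hn. specialize (HbR n ltac:(lra)). lra. }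
  (* Equality in both $g(a)\ge b$ and $g(b)\le a$ would give [a] period 2. So the image of $[a,b]$
     extends strictly beyond the gap on one side, where orbit points accumulate. *)
  assert (Henter : exists m s, a <= s <= b /\ g s = iter g m x).
  { assert (Hcase : b < g a \/ g b < a).
    { destruct (Rlt_dec b (g a)) as [|Hn1]; [now left|].
      destruct (Rlt_dec (g b) a) as [|Hn2]; [now right|].
      exfalso. apply (closure_aperiodic g x a 2 Hg Hx Hap Hacl); [lia|].
      change (g (g a) = a). replace (g a) with b by lra. lra. }
    assert (Hm : exists m, g b <= iter g m x <= g a).
    { destruct Hcase as [H|H].
      - destruct (Hbnear (g a - b)) as [m [Hm _]]; [lra|]. exists m; lra.
      - destruct (Hanear (a - g b)) as [m [Hm _]]; [lra|]. exists m; lra. }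
    destruct Hm as [m Hm].
    destruct (ivt g a b b a (iter g m x) Hc) as [s [Hs E]]; [lra..|].
    now exists m, s. }
  destruct Henter as (m & s & Hs & Es).
  exists m; intros n Hn.
  assert (Esn : iter g (S (n - m)) s = iter g n x).
  { rewrite iter_S_r, Es, <- iter_add. f_equal; lia. }
  split; intros [H1 H2].
  - assert (H3 := HaL n H1). assert (H4 := HaL (S n) H2). rewrite iter_S in H4.
    assert (iter g n x <> a) by (intros E; rewrite E in H4; lra).
    apply (no_escape_left g a b (iter g n x) s (S (n - m))); try assumption; lra.
  - assert (H3 := HbR n H1). assert (H4 := HbR (S n) H2). rewrite iter_S in H4.
    assert (iter g n x <> b) by (intros E; rewrite E in H4; lra).
    apply (no_escape_right g a b (iter g n x) s (S (n - m))); try assumption; lra.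
Qed.

(** * Proximal pairs of a tame map *)

Lemma iterates_uniform (g : R -> R) (M : nat) (eta : R) : continuity g -> eta > 0 ->
  exists delta, delta > 0 /\ forall r s t, (r < M)%nat -> I01 s -> I01 t ->
    Rabs (s - t) < delta -> Rabs (iter g r s - iter g r t) < eta.
Proof.
  intros Hg He; induction M as [|M [d [Hd H]]].
  - exists 1; split; [lra|]. intros; lia.
  - destruct (Heine (iter g M) (fun c => 0 <= c <= 1) (compact_P3 0 1)
      (fun x _ => iter_continuity g M Hg x) (mkposreal eta He)) as [d' H'].
    exists (Rmin d d'); split; [apply Rmin_glb_lt; [exact Hd|apply cond_pos]|].
    intros r s t Hr Hs Ht Hst.
    assert (Rabs (s - t) < d) by (eapply Rlt_le_trans; [exact Hst|apply Rmin_l]).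
    assert (Rabs (s - t) < d') by (eapply Rlt_le_trans; [exact Hst|apply Rmin_r]).
    destruct (Nat.eq_dec r M) as [->|]; [now apply H'|]. apply H; try assumption; lia.
Qed.

Lemma Prox_sym (g : R -> R) (x y : R) : Prox g x y -> Prox g y x.
Proof.
  intros H eta He N. destruct (H eta He N) as [n [Hn Hn']].
  exists n; split; [exact Hn|]. unfold odist in *. now rewrite Rabs_minus_sym.
Qed.

Lemma SProx_sym (g : R -> R) (x y : R) : SProx g x y -> SProx g y x.
Proof.
  intros H eta He B HB. destruct (H eta He B HB) as [n [Hn Hn']].
  exists n; split; [|exact Hn']. unfold odist in *. now rewrite Rabs_minus_sym.
Qed.

Lemma Prox_refl (g : R -> R) (x : R) : Prox g x x.
Proof.
  intros eta He N. exists N; split; [lia|]. unfold odist. now rewrite Rminus_diag, Rabs_R0.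
Qed.

(** After a close approach the orbits remain close up to the next time in the progression, by
    uniform continuity of the first $M$ iterates. *)
Lemma Prox_iter (g : R -> R) (x y : R) (M i : nat) : interval_map g -> I01 x -> I01 y ->
  (1 <= M)%nat -> Prox g x y -> Prox (iter g M) (iter g i x) (iter g i y).
Proof.
  intros Hg Hx Hy HM H eta He N.
  destruct (iterates_uniform g M eta (proj1 Hg) He) as [d [Hd Hd']].
  destruct (H d Hd (N * M + i)%nat) as [k [Hk Hk']]. unfold odist in Hk'.
  destruct (next_multiple M (k - i) HM) as [r [n [Hr Hn]]].
  exists n; split; [nia|]. unfold odist.
  rewrite !iter_mul, <- !iter_add.
  replace (n * M + i)%nat with (r + k)%nat by lia. rewrite !iter_add.
  apply Hd'; try assumption; now apply iter_I01.
Qed.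

Lemma Asy_SProx (g : R -> R) (x y : R) : Asy g x y -> SProx g x y.
Proof.
  intros H eta He B HB. destruct (H eta He) as [N HN].
  destruct (HB (S N)) as [m Hm]. exists (m + N)%nat; split; [apply HN; lia|apply Hm; lia].
Qed.

(** Pigeonhole: if along each of the $M$ residue classes the orbit eventually kept a positive
    distance from $w$, so would the whole orbit. *)
Lemma clusters_residue (g : R -> R) (x w : R) (M : nat) : (1 <= M)%nat ->
  clusters g x w -> exists r, (r < M)%nat /\ clusters (iter g M) (iter g r x) w.
Proof.
  intros HM Hacc. apply NNPP; intros Hnone.
  assert (Hfar : forall K, (K <= M)%nat -> exists eta N, eta > 0 /\ forall r n,
    (r < K)%nat -> (N <= n)%nat -> eta <= Rabs (iter (iter g M) n (iter g r x) - w)).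
  { induction K as [|K IH]; intros HK; [exists 1, 0%nat; split; [lra|intros; lia]|].
    destruct IH as (e & N & He & H); [lia|].
    assert (Hex : exists e' N', e' > 0 /\ forall n, (N' <= n)%nat ->
      e' <= Rabs (iter (iter g M) n (iter g K x) - w)).
    { apply NNPP; intros Hn. apply Hnone. exists K; split; [lia|].
      intros e' He' N'. apply NNPP; intros Hn'. apply Hn. exists e', N'; split; [exact He'|].
      intros n Hn2. apply Rnot_lt_le; intros Hlt. apply Hn'. now exists n. }
    destruct Hex as (e' & N' & He' & H').
    exists (Rmin e e'), (N + N')%nat; split; [now apply Rmin_glb_lt|].
    intros r n Hr Hn. destruct (Nat.eq_dec r K) as [->|Hne].
    - eapply Rle_trans; [apply Rmin_r|apply H'; lia].
    - eapply Rle_trans; [apply Rmin_l|apply H; lia]. }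
  destruct (Hfar M (le_n M)) as (e & N & He & H).
  destruct (Hacc e He (S N * M)%nat) as [k [Hk Hk']].
  assert (E := Nat.div_mod_eq k M). assert (Hlt := Nat.mod_upper_bound k M ltac:(lia)).
  specialize (H (k mod M)%nat (k / M)%nat Hlt ltac:(nia)).
  rewrite iter_mul, <- iter_add in H.
  replace (k / M * M + k mod M)%nat with k in H by lia. lra.
Qed.

(** Along one residue class $x$ converges to a periodic point $w$. By proximality $y$ clusters at
    $w$ along the same class, hence converges too, and uniform continuity fills in the remaining
    times. *)
Lemma periodic_proximal_asymptotic (g : R -> R) (x y : R) : interval_map g -> tame g ->
  I01 x -> I01 y -> Prox g x y -> ~ aperiodic g x -> Asy g x y.
Proof.
  intros Hg Htame Hx Hy Hprox Hper.
  assert (Hex : exists M w, (1 <= M)%nat /\ I01 w /\ iter g M w = w /\ clusters g x w).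
  { apply NNPP; intros Hn; apply Hper. intros M w HM Hw Ew Hacc. apply Hn.
    now exists M, w. }
  destruct Hex as (M & w & HM & Hw & Ew & Hacc).
  destruct (clusters_residue g x w M HM Hacc) as [r [Hr Hr']].
  assert (HgM := interval_map_iter g M Hg). assert (HtM := tame_iter g M HM Htame).
  assert (HxI := iter_I01 g r x Hg Hx). assert (HyI := iter_I01 g r y Hg Hy).
  assert (Hcx : converges (iter g M) (iter g r x) w) by now apply clusters_converges.
  assert (HpM := Prox_iter g x y M r Hg Hx Hy HM Hprox).
  assert (Hcy : converges (iter g M) (iter g r y) w).
  { apply clusters_converges; try assumption.
    intros eta He N. destruct (Hcx (eta / 2)) as [N' HN']; [lra|].
    destruct (HpM (eta / 2) ltac:(lra) (N + N')%nat) as [n [Hn Hn']].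
    specialize (HN' n ltac:(lia)). unfold odist in Hn'.
    exists n; split; [lia|]. apply Rabs_def2 in HN', Hn'. apply Rabs_def1; lra. }
  intros eta He.
  destruct (iterates_uniform g M eta (proj1 Hg) He) as [d [Hd Hd']].
  destruct (Hcx (d / 2)) as [N1 H1]; [lra|]. destruct (Hcy (d / 2)) as [N2 H2]; [lra|].
  exists (S (N1 + N2) * M + r)%nat; intros k Hk.
  assert (E := Nat.div_mod_eq (k - r) M).
  assert (Hlt := Nat.mod_upper_bound (k - r) M ltac:(lia)).
  set (n := ((k - r) / M)%nat) in *. set (s := ((k - r) mod M)%nat) in *.
  specialize (H1 n ltac:(nia)). specialize (H2 n ltac:(nia)).
  unfold odist. replace k with (s + (n * M + r))%nat by nia.
  rewrite !(iter_add g s). rewrite iter_mul, <- iter_add in H1, H2.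
  apply Hd'; try assumption; try (now apply iter_I01).
  apply Rabs_def2 in H1, H2. apply Rabs_def1; lra.
Qed.

(** Let $a$ be the supremum of all points of both orbits that move up and $b$ the infimum of those
    that move down. [proximal_up_le_down], also used for an orbit with itself, gives $a\le b$. By
    continuity $g(a)\ge a$ and $g(b)\le b$, so $[a,b]$ contains a fixed point. *)
Lemma common_fixed_point (g : R -> R) (x y : R) : interval_map g -> tame g ->
  I01 x -> I01 y -> Prox g x y -> aperiodic g x ->
  exists z, I01 z /\ g z = z /\ forall p n, p = x \/ p = y ->
    (iter g n p < iter g (S n) p -> iter g n p <= z) /\
    (iter g (S n) p < iter g n p -> z <= iter g n p).
Proof.
  intros Hg Htame Hx Hy Hprox Hap.
  assert (Hud : forall p q i j, (p = x \/ p = y) -> (q = x \/ q = y) ->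
    iter g i p < iter g (S i) p -> iter g (S j) q < iter g j q -> iter g i p <= iter g j q).
  { intros p q i j Hp Hq. apply proximal_up_le_down; try assumption;
      destruct Hp as [->| ->], Hq as [->| ->]; try assumption;
      auto using Prox_refl, Prox_sym. }
  assert (HI : forall p n, (p = x \/ p = y) -> I01 (iter g n p)).
  { intros p n [->| ->]; now apply iter_I01. }
  destruct (aperiodic_goes_up g x Hg Hx Hap) as [nu Hnu].
  destruct (aperiodic_goes_down g x Hg Hx Hap) as [nd Hnd].
  destruct (completeness (fun s => exists p n, (p = x \/ p = y) /\ s = iter g n p /\
    iter g n p < iter g (S n) p)) as [a [Haub Halub]].
  { exists 1. intros s (p & n & Hp & -> & _). now apply HI. }
  { exists (iter g nu x), x, nu; auto. }
  assert (Hax : iter g nu x <= a) by (apply Haub; exists x, nu; auto).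
  assert (Had : forall p n, (p = x \/ p = y) -> iter g (S n) p < iter g n p ->
    a <= iter g n p).
  { intros p n Hp Hdown. apply Halub. intros s (q & i & Hq & -> & Hup).
    now apply (Hud q p). }
  assert (Hxd := Had x nd (or_introl eq_refl) Hnd).
  assert (Hx0 := HI x nu (or_introl eq_refl)). assert (Hx1 := HI x nd (or_introl eq_refl)).
  unfold I01 in Hx0, Hx1.
  assert (Hga : a <= g a).
  { apply Rnot_lt_le; intros Hlt.
    destruct (continuity_eps g a ((a - g a) / 2) (proj1 Hg)) as [d [Hd H]]; [lra|].
    assert (a <= a - Rmin d ((a - g a) / 2)).
    { apply Halub. intros s (p & n & Hp & Es & Hup). apply Rnot_lt_le; intros Hs.
      assert (s <= a) by (apply Haub; exists p, n; auto).
      assert (Rmin d ((a - g a) / 2) <= d) by apply Rmin_l.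
      assert (Rmin d ((a - g a) / 2) <= (a - g a) / 2) by apply Rmin_r.
      assert (Hnear : Rabs (g s - g a) < (a - g a) / 2) by (apply H, Rabs_def1; lra).
      apply Rabs_def2 in Hnear. rewrite iter_S, <- Es in Hup. lra. }
    assert (0 < Rmin d ((a - g a) / 2)) by (apply Rmin_glb_lt; lra). lra. }
  destruct (completeness (fun s => exists p n, (p = x \/ p = y) /\ - s = iter g n p /\
    iter g (S n) p < iter g n p)) as [b' [Hbub Hblub]].
  { exists 0. intros s (p & n & Hp & Es & _). specialize (HI p n Hp). unfold I01 in HI. lra. }
  { exists (- iter g nd x), x, nd. rewrite Ropp_involutive; auto. }
  set (b := - b').
  assert (Hbd : forall p n, (p = x \/ p = y) -> iter g (S n) p < iter g n p ->
    b <= iter g n p).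
  { intros p n Hp Hdown. assert (- iter g n p <= b'); [|unfold b; lra].
    apply Hbub. exists p, n. rewrite Ropp_involutive; auto. }
  assert (Hab : a <= b).
  { assert (b' <= - a); [|unfold b; lra].
    apply Hblub. intros s (p & n & Hp & Es & Hdown). specialize (Had p n Hp Hdown). lra. }
  assert (Hgb : g b <= b).
  { apply Rnot_lt_le; intros Hlt.
    destruct (continuity_eps g b ((g b - b) / 2) (proj1 Hg)) as [d [Hd H]]; [lra|].
    assert (b' <= b' - Rmin d ((g b - b) / 2)).
    { apply Hblub. intros s (p & n & Hp & Es & Hup). apply Rnot_lt_le; intros Hs.
      assert (b <= - s) by (rewrite Es; now apply Hbd).
      assert (Rmin d ((g b - b) / 2) <= d) by apply Rmin_l.
      assert (Rmin d ((g b - b) / 2) <= (g b - b) / 2) by apply Rmin_r.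
      assert (Hnear : Rabs (g (- s) - g b) < (g b - b) / 2)
        by (apply H, Rabs_def1; unfold b in *; lra).
      apply Rabs_def2 in Hnear. rewrite iter_S, <- Es in Hup. unfold b in *; lra. }
    assert (0 < Rmin d ((g b - b) / 2)) by (apply Rmin_glb_lt; lra). lra. }
  assert (Hbx := Hbd x nd (or_introl eq_refl) Hnd).
  destruct (ivt (fun s => s - g s) a b a b 0) as [z [Hz Ez]]; try lra.
  { apply (continuity_minus (fun s => s) g); [|apply Hg].
    apply derivable_continuous, derivable_id. }
  exists z; split; [unfold I01; lra|split; [lra|]].
  intros p n Hp; split; intros Hm.
  - assert (iter g n p <= a) by (apply Haub; exists p, n; auto). lra.
  - specialize (Hbd p n Hp Hm). lra.
Qed.

Lemma proximal_alternation (g : R -> R) (x y : R) : interval_map g -> tame g ->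
  I01 x -> I01 y -> Prox g x y -> aperiodic g x -> aperiodic g y ->
  exists z m, forall n, (m <= n)%nat ->
    (iter g n x < z /\ iter g n y < z /\ z < iter g (S n) x /\ z < iter g (S n) y) \/
    (z < iter g n x /\ z < iter g n y /\ iter g (S n) x < z /\ iter g (S n) y < z).
Proof.
  intros Hg Htame Hx Hy Hprox Hax Hay.
  destruct (common_fixed_point g x y Hg Htame Hx Hy Hprox Hax) as (z & Hz & Ez & Hsep).
  assert (Halt : forall p, p = x \/ p = y -> I01 p -> aperiodic g p ->
    exists m, forall n, (m <= n)%nat ->
    ~ (iter g n p < z /\ iter g (S n) p < z) /\ ~ (z < iter g n p /\ z < iter g (S n) p)).
  { intros p Hp HpI Hap. apply alternation; try assumption.
    - intros n Hn. assert (Hne := orbit_aperiodic g p n Hg HpI Hap).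
      rewrite <- iter_S in Hne. apply Rnot_le_lt; intros Hle.
      assert (z <= iter g n p) by (apply Hsep; [assumption|lra]). lra.
    - intros n Hn. assert (Hne := orbit_aperiodic g p n Hg HpI Hap).
      rewrite <- iter_S in Hne. apply Rnot_le_lt; intros Hle.
      assert (iter g n p <= z) by (apply Hsep; [assumption|lra]). lra. }
  assert (Hoff : forall p, I01 p -> aperiodic g p -> forall n, iter g n p <> z).
  { intros p HpI Hap n E. apply (orbit_aperiodic g p n Hg HpI Hap). now rewrite E. }
  assert (Hgap : exists d, d > 0 /\ forall n, d <= Rabs (iter g n x - z)).
  { apply NNPP; intros Hn. apply (closure_aperiodic g x z 1 Hg Hx Hax); [|lia|exact Ez].
    intros eta He. apply NNPP; intros Hn'. apply Hn. exists eta; split; [exact He|].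
    intros n; apply Rnot_lt_le; intros Hlt; apply Hn'; now exists n. }
  destruct Hgap as [d [Hd Hgap]].
  destruct (Halt x (or_introl eq_refl) Hx Hax) as [m1 H1].
  destruct (Halt y (or_intror eq_refl) Hy Hay) as [m2 H2].
  (* At a time when the orbits are closer than the distance from the orbit of [x] to [z], they are
     on the same side of [z]; strict alternation keeps them in phase from then on. *)
  destruct (Hprox d Hd (m1 + m2)%nat) as [m [Hm Hm']].
  assert (Hside : forall n, (m <= n)%nat ->
    (iter g n x < z /\ iter g n y < z) \/ (z < iter g n x /\ z < iter g n y)).
  { intros n Hn; induction Hn as [|n Hn IH].
    - unfold odist in Hm'. specialize (Hgap m). apply Rabs_def2 in Hm'.
      assert (Hyz := Hoff y Hy Hay m).
      destruct (Rtotal_order (iter g m x) z) as [Hlt|[Heq|Hgt]].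
      + rewrite Rabs_left in Hgap by lra. left; lra.
      + now apply Hoff in Heq.
      + rewrite Rabs_right in Hgap by lra. right; lra.
    - destruct (H1 n ltac:(lia)) as [A1 A2], (H2 n ltac:(lia)) as [B1 B2].
      assert (Hxz := Hoff x Hx Hax (S n)). assert (Hyz := Hoff y Hy Hay (S n)).
      destruct IH as [[C D]|[C D]]; [right|left]; split; apply Rnot_le_lt; intros Hle;
        [apply A1|apply B1|apply A2|apply B2]; lra. }
  exists z, m; intros n Hn.
  destruct (H1 n ltac:(lia)) as [A1 A2], (H2 n ltac:(lia)) as [B1 B2].
  destruct (Hside n Hn) as [[C D]|[C D]], (Hside (S n) ltac:(lia)) as [[C' D']|[C' D']];
    tauto.
Qed.

Lemma aperiodic_iter (g : R -> R) (x : R) (M i : nat) : (1 <= M)%nat ->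
  aperiodic g x -> aperiodic (iter g M) (iter g i x).
Proof.
  intros HM Hap K w HK Hw Ew Hacc. rewrite iter_mul in Ew.
  apply (Hap (K * M)%nat w); [nia|exact Hw|exact Ew|].
  intros eta He N. destruct (Hacc eta He N) as [n [Hn Hn']].
  rewrite iter_mul, <- iter_add in Hn'. exists (n * M + i)%nat; split; [nia|exact Hn'].
Qed.

(* The orbits split at [z] into two halves of [[p, q]] visited alternately;
   pass to [g^2] on the shorter half and repeat. *)
Lemma proximal_progression (k : nat) : forall (g : R -> R) (x y p q : R) (N : nat),
  interval_map g -> tame g -> I01 x -> I01 y -> Prox g x y ->
  aperiodic g x -> aperiodic g y ->
  (forall n, (N <= n)%nat -> p <= iter g n x <= q /\ p <= iter g n y <= q) ->
  exists M r, (1 <= M)%nat /\ forall n, odist g x y (n * M + r) <= (q - p) / 2 ^ k.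
Proof.
  induction k as [|k IH]; intros g x y p q N Hg Htame Hx Hy Hprox Hax Hay Hpq.
  - exists 1%nat, N; split; [lia|]. intros n. unfold odist.
    destruct (Hpq (n * 1 + N)%nat ltac:(lia)) as [H1 H2].
    simpl; apply Rabs_le; lra.
  - destruct (proximal_alternation g x y) as (z & m & Hz); try assumption.
    assert (Hr0 : exists r p' q', q' - p' <= (q - p) / 2 /\
      forall n, p' <= iter g (n * 2 + r) x <= q' /\ p' <= iter g (n * 2 + r) y <= q').
    { set (n0 := (N + m)%nat).
      assert (Hlr : exists r0 r1, (n0 <= r0 /\ n0 <= r1)%nat /\
        (iter g r0 x < z /\ iter g r0 y < z) /\ (z < iter g r1 x /\ z < iter g r1 y)).
      { destruct (Hz n0) as [H|H]; [unfold n0; lia|exists n0, (S n0)|exists (S n0), n0];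
          repeat split; try lia; tauto. }
      destruct Hlr as (r0 & r1 & [Hn0 Hn1] & HL & HR).
      destruct (Rle_dec (z - p) ((q - p) / 2)) as [Hle|Hgt].
      - exists r0, p, z; split; [lra|]. intros n.
        assert (H : iter g (n * 2 + r0) x < z /\ iter g (n * 2 + r0) y < z).
        { induction n as [|n IHn]; [exact HL|].
          destruct (Hz (n * 2 + r0)%nat) as [H|H]; [unfold n0 in *; lia| |lra].
          destruct (Hz (S (n * 2 + r0))) as [H'|H']; [unfold n0 in *; lia|lra|].
          replace (S n * 2 + r0)%nat with (S (S (n * 2 + r0))) by lia. tauto. }
        destruct (Hpq (n * 2 + r0)%nat); [unfold n0 in *; lia|lra].
      - exists r1, z, q; split; [lra|]. intros n.
        assert (H : z < iter g (n * 2 + r1) x /\ z < iter g (n * 2 + r1) y).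
        { induction n as [|n IHn]; [exact HR|].
          destruct (Hz (n * 2 + r1)%nat) as [H|H]; [unfold n0 in *; lia|lra|].
          destruct (Hz (S (n * 2 + r1))) as [H'|H']; [unfold n0 in *; lia| |lra].
          replace (S n * 2 + r1)%nat with (S (S (n * 2 + r1))) by lia. tauto. }
        destruct (Hpq (n * 2 + r1)%nat); [unfold n0 in *; lia|lra]. }
    destruct Hr0 as (r & p' & q' & Hlen & Hin).
    destruct (IH (iter g 2) (iter g r x) (iter g r y) p' q' 0%nat) as (M & s & HM & H);
      try (now apply iter_I01); try (apply aperiodic_iter; [lia|assumption]).
    + now apply interval_map_iter.
    + apply tame_iter; [lia|assumption].
    + apply Prox_iter; try assumption; lia.
    + intros n _. rewrite !iter_mul, <- !iter_add. apply Hin.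
    + exists (M * 2)%nat, (s * 2 + r)%nat; split; [lia|]. intros n.
      specialize (H n). unfold odist in *. rewrite !iter_mul, <- !iter_add in H.
      replace (n * (M * 2) + (s * 2 + r))%nat with ((n * M + s) * 2 + r)%nat by lia.
      eapply Rle_trans; [exact H|].
      assert (0 < 2 ^ k) by (apply pow_lt; lra).
      apply Rle_trans with ((q - p) / 2 / 2 ^ k).
      * apply Rmult_le_compat_r; [left; now apply Rinv_0_lt_compat|exact Hlen].
      * simpl. right. field. lra.
Qed.

Lemma tame_Prox_SProx (g : R -> R) (x y : R) : interval_map g -> tame g ->
  I01 x -> I01 y -> Prox g x y -> SProx g x y.
Proof.
  intros Hg Htame Hx Hy Hprox.
  destruct (classic (aperiodic g x)) as [Hax|Hax];
    [|now apply Asy_SProx, periodic_proximal_asymptotic].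
  destruct (classic (aperiodic g y)) as [Hay|Hay];
    [|now apply SProx_sym, Asy_SProx, periodic_proximal_asymptotic; auto using Prox_sym].
  intros eta He B HB.
  destruct (pow_lt_1_zero (1 / 2)) with (y := eta) as [k Hk]; [rewrite Rabs_right; lra|lra|].
  specialize (Hk k (le_n k)).
  destruct (proximal_progression k g x y 0 1 0 Hg Htame Hx Hy Hprox Hax Hay)
    as (M & r & HM & H).
  { intros n _. split; now apply iter_I01. }
  (* A run of length [r + M] contains a term of the progression [n * M + r]. *)
  destruct (HB (r + M)%nat) as [m Hm].
  destruct (next_multiple M m HM) as (r' & n & Hr' & Hn).
  exists (n * M + r)%nat; split.
  - eapply Rle_lt_trans; [apply H|].
    replace ((1 - 0) / 2 ^ k) with ((1 / 2) ^ k).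
    + apply Rabs_def2 in Hk. lra.
    + unfold Rdiv. rewrite !Rmult_1_l, Rminus_0_r, Rmult_1_l. apply pow_inv.
  - replace (n * M + r)%nat with (m + (r + r'))%nat by lia. apply Hm. lia.
Qed.

(** * Consequences of a horseshoe *)

(** The positive gap [c - b] between the legs supplies the constants of separation. *)
Definition strict_horseshoe (g : R -> R) (l r a b c d : R) : Prop :=
  (0 <= l /\ l < r /\ r <= 1) /\ (l <= a /\ a < b /\ b < c /\ c < d /\ d <= r) /\
  covers g a b l r /\ covers g c d l r.

Lemma covers_lt (g : R -> R) (a b l r : R) : l < r -> covers g a b l r -> a < b.
Proof.
  intros Hlr [[u [Hu Hu']] [v [Hv Hv']]].
  assert (u <> v) by (intros ->; lra). lra.
Qed.

(** Inside $[a,b]$ lie two apart intervals that cover $[l,r]$ under $g^2$. The left one ends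
    strictly before $b\le c$, hence at a positive distance from $[c,d]$, which serves as the second
    leg. *)
Lemma horseshoe_strict (g : R -> R) : continuity g -> horseshoe g ->
  exists l r a b c d, strict_horseshoe (iter g 2) l r a b c d.
Proof.
  intros Hg (l & r & a & b & c & d & H1 & H2 & H3 & H4 & H5 & H6 & C1 & C2).
  assert (Hab := covers_lt _ _ _ _ _ H2 C1). assert (Hcd := covers_lt _ _ _ _ _ H2 C2).
  assert (D1 : covers g a b a b) by (apply (covers_sub g a b l r); [assumption|lra..]).
  assert (D2 : covers g a b c d) by (apply (covers_sub g a b l r); [assumption|lra..]).
  assert (D3 : covers g c d c d) by (apply (covers_sub g c d l r); [assumption|lra..]).
  destruct (pullback g a b a b Hg Hab D1) as (u1 & v1 & Hu1 & Huv1 & Hv1 & E1 & _ & I1).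
  destruct (pullback g a b c d Hg Hcd D2) as (u2 & v2 & Hu2 & Huv2 & Hv2 & E2 & _ & I2).
  assert (Hcov2 : covers (iter g 2) c d l r) by exact (covers_iter_add g 1 1 _ _ _ _ _ _ Hg D3 C2).
  assert (Hap : apart u1 v1 u2 v2).
  { apply (pullback_apart g _ _ _ _ a b c d); try assumption. intros s Hs Hs'; lra. }
  destruct (apart_le u1 v1 u2 v2 Huv1 Huv2 Hap) as [Hle|Hle].
  - exists l, r, u1, v1, c, d. repeat split; try lra; try apply Hcov2;
      apply (covers_iter_add g 1 1 _ _ _ _ _ _ Hg E1 C1).
  - exists l, r, u2, v2, c, d. repeat split; try lra; try apply Hcov2;
      apply (covers_iter_add g 1 1 _ _ _ _ _ _ Hg E2 C2).
Qed.

Lemma covers_lift (g : R -> R) (a b l r : R) (S : list R) : continuity g ->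
  covers g a b l r -> (forall s, In s S -> l <= s <= r) ->
  exists S', map g S' = S /\ forall x, In x S' -> a <= x <= b.
Proof.
  intros Hg Hc; induction S as [|s S IH]; intros HS.
  - exists nil; split; [reflexivity|]. intros x [].
  - destruct IH as [S' [E H]]; [intros; apply HS; now right|].
    destruct (covers_point g a b l r s Hg Hc) as [x [Hx Ex]]; [apply HS; now left|].
    exists (x :: S'); split; [simpl; congruence|].
    intros y [<-|Hy]; auto.
Qed.

Lemma odist_S (g : R -> R) (x y : R) (k : nat) : odist g x y (S k) = odist g (g x) (g y) k.
Proof. unfold odist. now rewrite !iter_S_r. Qed.

Lemma odist_iter (g : R -> R) (x y : R) (m k : nat) :
  odist (iter g m) x y k = odist g x y (k * m).
Proof. unfold odist. now rewrite !iter_mul. Qed.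

(** The set is lifted into both legs, which doubles it: points in different legs are apart at time
    0, points in the same leg are separated one step later than their images. Half the gap makes the
    inequality strict. *)
Lemma horseshoe_separated (g : R -> R) (l r a b c d : R) (n : nat) : continuity g ->
  strict_horseshoe g l r a b c d ->
  exists S, length S = (2 ^ n)%nat /\ (forall x, In x S -> l <= x <= r) /\
    separated g n ((c - b) / 2) S.
Proof.
  intros Hg (HI & HK & C1 & C2); induction n as [|n (S & Hlen & HS & Hnd & _ & Hsep)].
  - exists (l :: nil). split; [reflexivity|split; [|split; [|split]]].
    + intros x [<-|[]]; lra.
    + constructor; [intros []|constructor].
    + intros x [<-|[]]; unfold I01; lra.
    + intros x y [<-|[]] [<-|[]] H; congruence.
  - destruct (covers_lift g a b l r S Hg C1 HS) as [S1 [E1 H1]].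
    destruct (covers_lift g c d l r S Hg C2 HS) as [S2 [E2 H2]].
    assert (Hlift : forall S' x y, map g S' = S -> In x S' -> In y S' -> x <> y ->
      NoDup S' -> exists k, (k < Datatypes.S n)%nat /\ odist g x y k > (c - b) / 2).
    { intros S' x y E Hx Hy Hxy Hnd'.
      assert (Hgxy : g x <> g y).
      { intros Eg. apply Hxy. clear - Hnd E Eg Hx Hy. rewrite <- E in Hnd.
        clear E. induction S' as [|s S' IH]; [destruct Hx|].
        simpl in Hnd; inversion Hnd as [|? ? Hn Hd]; subst.
        destruct Hx as [->|Hx], Hy as [->|Hy]; auto.
        - exfalso; apply Hn. rewrite Eg. now apply in_map.
        - exfalso; apply Hn. rewrite <- Eg. now apply in_map. }
      destruct (Hsep (g x) (g y)) as [k [Hk Hk']]; try assumption;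
        try (rewrite <- E; now apply in_map).
      exists (Datatypes.S k); split; [lia|]. now rewrite odist_S. }
    assert (N1 : NoDup S1) by (apply (NoDup_map_inv g); now rewrite E1).
    assert (N2 : NoDup S2) by (apply (NoDup_map_inv g); now rewrite E2).
    assert (Hfar : forall x y, In x S1 -> In y S2 -> odist g x y 0 > (c - b) / 2).
    { intros x y Hx Hy. specialize (H1 x Hx); specialize (H2 y Hy).
      unfold odist, iter; simpl. rewrite Rabs_left; lra. }
    exists (S1 ++ S2); split; [|split; [|split; [|split]]].
    + rewrite length_app, <- (length_map g S1), <- (length_map g S2), E1, E2, Hlen.
      simpl; lia.
    + intros x Hx. apply in_app_or in Hx as [Hx|Hx]; [specialize (H1 x Hx)|specialize (H2 x Hx)]; lra.
    + apply NoDup_app; try assumption.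
      intros x Hx Hx'. specialize (H1 x Hx); specialize (H2 x Hx'). lra.
    + intros x Hx. unfold I01.
      apply in_app_or in Hx as [Hx|Hx]; [specialize (H1 x Hx)|specialize (H2 x Hx)]; lra.
    + intros x y Hx Hy Hxy.
      apply in_app_or in Hx as [Hx|Hx]; apply in_app_or in Hy as [Hy|Hy].
      * now apply (Hlift S1).
      * exists 0%nat; split; [lia|]. now apply Hfar.
      * exists 0%nat; split; [lia|]. unfold odist; rewrite Rabs_minus_sym. now apply Hfar.
      * now apply (Hlift S2).
Qed.

Lemma horseshoe_entropy (f : R -> R) (m : nat) (l r a b c d : R) : continuity f ->
  (1 <= m)%nat -> strict_horseshoe (iter f m) l r a b c d -> pos_entropy f.
Proof.
  intros Hf Hm Hs. assert (Hbc : b < c) by (destruct Hs as (_ & H & _); lra).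
  assert (Hm0 : 0 < INR m) by (apply lt_0_INR; lia).
  assert (Hln := ln_lt_2).
  (* $2^n$ orbits are separated under $f^m$ within $n$ steps, hence under $f$ within $nm$ steps. *)
  exists ((c - b) / 2), (ln 2 / INR m). split; [lra|split].
  { apply Rdiv_lt_0_compat; lra. }
  intros N. exists (S N * m)%nat. split; [nia|split; [nia|]].
  destruct (horseshoe_separated (iter f m) l r a b c d (S N)) as (S & Hlen & _ & Hnd & HI & Hsep);
    [now apply iter_continuity|exact Hs|].
  exists S; split; [split; [exact Hnd|split; [exact HI|]]|].
  - intros x y Hx Hy Hxy. destruct (Hsep x y Hx Hy Hxy) as [k [Hk Hk']].
    exists (k * m)%nat; split; [nia|]. now rewrite <- odist_iter.
  - rewrite Hlen, pow_INR, mult_INR. change (INR 2) with 2.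
    rewrite <- (Rpower_pow (Datatypes.S N) 2) by lra. unfold Rpower.
    right; f_equal. field. lra.
Qed.

(** Pulling both legs back into the previous interval gives two apart intervals; the shorter has at
    most half the length. *)
Lemma horseshoe_short_covers (g : R -> R) (l r a b c d : R) (k : nat) : continuity g ->
  strict_horseshoe g l r a b c d ->
  exists p q, l <= p /\ q <= r /\ q - p <= (r - l) / 2 ^ k /\ covers (iter g k) p q l r.
Proof.
  intros Hg (HI & HK & C1 & C2); induction k as [|k (p & q & Hp & Hq & Hlen & Hc)].
  - exists l, r; repeat split; simpl; try lra; [exists l|exists r]; unfold iter; simpl; lra.
  - assert (Hgk := iter_continuity g k Hg).
    destruct (pullback (iter g k) p q a b) as (u1 & v1 & Hu1 & Huv1 & Hv1 & E1 & _ & I1);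
      [assumption|lra|apply (covers_sub _ _ _ l r); [assumption|lra..]|].
    destruct (pullback (iter g k) p q c d) as (u2 & v2 & Hu2 & Huv2 & Hv2 & E2 & _ & I2);
      [assumption|lra|apply (covers_sub _ _ _ l r); [assumption|lra..]|].
    assert (Hap : apart u1 v1 u2 v2).
    { apply (pullback_apart (iter g k) _ _ _ _ a b c d); try assumption.
      intros s Hs Hs'; lra. }
    assert (Hhalf : (r - l) / 2 ^ S k = (r - l) / 2 ^ k / 2).
    { simpl. field. apply pow_nonzero. lra. }
    assert (F1 := covers_iter_add g 1 k _ _ _ _ _ _ Hg E1 C1).
    assert (F2 := covers_iter_add g 1 k _ _ _ _ _ _ Hg E2 C2).
    destruct (Rle_dec (v1 - u1) (v2 - u2)) as [Hle|Hgt];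
      destruct (apart_le u1 v1 u2 v2 Huv1 Huv2 Hap) as [Hord|Hord].
    1, 2: exists u1, v1; repeat split; try lra; apply F1.
    1, 2: exists u2, v2; repeat split; try lra; apply F2.
Qed.

(** * Points with prescribed itineraries *)

Definition closed_under_limits (C : R -> Prop) : Prop :=
  forall x, (forall d, d > 0 -> exists y, Rabs (y - x) < d /\ C y) -> C x.

Lemma band_closed (h : R -> R) (lo hi : R) : continuity h ->
  closed_under_limits (fun x => lo <= h x <= hi).
Proof.
  intros Hh x Hx. split; apply Rnot_lt_le; intros Hlt.
  - destruct (continuity_eps h x (lo - h x) Hh) as [d [Hd H]]; [lra|].
    destruct (Hx d Hd) as [y [Hy Hy']]. apply H, Rabs_def2 in Hy. lra.
  - destruct (continuity_eps h x (h x - hi) Hh) as [d [Hd H]]; [lra|].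
    destruct (Hx d Hd) as [y [Hy Hy']]. apply H, Rabs_def2 in Hy. lra.
Qed.

Lemma compact_intersection (C : nat -> R -> Prop) :
  (forall j, closed_under_limits (C j)) ->
  (forall N, exists x, I01 x /\ forall j, (j < N)%nat -> C j x) ->
  exists x, I01 x /\ forall j, C j x.
Proof.
  intros Hcl Hfin.
  set (s := fun N => proj1_sig (constructive_indefinite_description _ (Hfin N))).
  assert (Hs : forall N, I01 (s N) /\ forall j, (j < N)%nat -> C j (s N))
    by (intros N; exact (proj2_sig (constructive_indefinite_description _ (Hfin N)))).
  clearbody s.
  destruct (cluster_point s) as [w [Hw Hcw]]; [intros N; apply Hs|].
  exists w; split; [exact Hw|]. intros j. apply Hcl. intros d Hd.
  destruct (Hcw d Hd (S j)) as [N [HN HN']]. exists (s N); split; [exact HN'|].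
  apply Hs; lia.
Qed.

(** Block $j$ takes $2j$ steps, and $\sum_{j<k}2j=k(k-1)$. *)
Definition block_start (k : nat) : nat := (k * pred k)%nat.

Lemma block_start_S (k : nat) : block_start (S k) = (block_start k + (k + k))%nat.
Proof. unfold block_start. destruct k; simpl; lia. Qed.

(** The first half of the block expands a short interval to $[l,r]$; the second half is spent in the
    leg $[lo,hi]$. *)
Definition follows_block (g : R -> R) (p q : nat -> R) (lo hi : R) (k : nat) (x : R) : Prop :=
  p k <= x <= q k /\ forall i, (i < k)%nat -> lo <= iter g (k + i) x <= hi.

(** Finitely many blocks are realised by pulling back from the last one; compactness gives a point
    for all blocks. *)
Lemma follow_blocks (g : R -> R) (p q : nat -> R) (l r lo hi : R) : continuity g ->
  0 <= l -> l < r -> r <= 1 -> l <= lo -> hi <= r -> covers g lo hi l r ->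
  (forall k, l <= p k /\ q k <= r /\ covers (iter g k) (p k) (q k) l r) ->
  exists x, I01 x /\ forall k, follows_block g p q lo hi k (iter g (block_start k) x).
Proof.
  intros Hg Hl Hlr Hr Hlo Hhi Hc Hpq.
  assert (Hrun : forall k y, l <= y <= r -> exists x, l <= x <= r /\
    iter g k x = y /\ forall i, (i < k)%nat -> lo <= iter g i x <= hi).
  { induction k as [|k IH]; intros y Hy.
    - exists y; repeat split; try lra; intros; lia.
    - destruct (IH y Hy) as (x & Hx & Ex & Hi).
      destruct (covers_point g lo hi l r x Hg Hc Hx) as [x' [Hx' E']].
      exists x'; split; [lra|split; [now rewrite iter_S_r, E'|]].
      intros [|i] Hik; [unfold iter; simpl; lra|]. rewrite iter_S_r, E'. apply Hi; lia. }
  assert (Hblock : forall k y, l <= y <= r -> exists x, l <= x <= r /\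
    iter g (k + k) x = y /\ follows_block g p q lo hi k x).
  { intros k y Hy. destruct (Hrun k y Hy) as (x & Hx & Ex & Hi).
    destruct (Hpq k) as (Hp & Hq & Hck).
    destruct (covers_point (iter g k) (p k) (q k) l r x (iter_continuity g k Hg) Hck Hx)
      as [x' [Hx' E']].
    exists x'; split; [lra|split; [now rewrite iter_add, E'|split; [exact Hx'|]]].
    intros i Hik. rewrite Nat.add_comm, iter_add, E'. now apply Hi. }
  (* The starting block [k] is arbitrary, so that the induction can put one more block in front. *)
  assert (Hfin : forall N k, exists x, l <= x <= r /\ forall j, (j < N)%nat ->
    follows_block g p q lo hi (k + j) (iter g (block_start (k + j) - block_start k) x)).
  { induction N as [|N IH]; intros k; [exists l; split; [lra|intros; lia]|].
    destruct (IH (S k)) as (y & Hy & Hj).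
    destruct (Hblock k y Hy) as (x & Hx & Ex & Hxk).
    exists x; split; [exact Hx|]. intros [|j] Hjn.
    - now rewrite Nat.add_0_r, Nat.sub_diag.
    - specialize (Hj j ltac:(lia)). replace (S k + j)%nat with (k + S j)%nat in Hj by lia.
      assert (Hle : (block_start (S k) <= block_start (k + S j))%nat)
        by (unfold block_start; nia).
      rewrite block_start_S in Hj, Hle.
      rewrite <- Ex, <- iter_add in Hj.
      now replace (block_start (k + S j) - (block_start k + (k + k)) + (k + k))%nat
        with (block_start (k + S j) - block_start k)%nat in Hj by lia. }
  apply (compact_intersection
    (fun k x => follows_block g p q lo hi k (iter g (block_start k) x))).
  - intros k x Hx. split.
    + apply (band_closed (iter g (block_start k))); [now apply iter_continuity|].
      intros d Hd. destruct (Hx d Hd) as [y [Hy [H _]]]. now exists y.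
    + intros i Hi. rewrite <- iter_add.
      apply (band_closed (iter g (k + i + block_start k))); [now apply iter_continuity|].
      intros d Hd. destruct (Hx d Hd) as [y [Hy [_ H]]]. exists y; split; [exact Hy|].
      rewrite iter_add. now apply H.
  - intros N. destruct (Hfin N 0%nat) as (x & Hx & H).
    exists x; split; [unfold I01; lra|]. intros j Hj. specialize (H j Hj).
    replace (block_start (0 + j) - block_start 0)%nat with (block_start j) in H; [exact H|].
    unfold block_start; simpl; lia.
Qed.

(* In block [k] both points visit a common interval of length at most [2^-k],
   then stay in different legs of the horseshoe for [k] steps. *)
Lemma horseshoe_Prox_not_SProx (f : R -> R) (m : nat) (l r a b c d : R) : interval_map f ->
  (1 <= m)%nat -> strict_horseshoe (iter f m) l r a b c d ->
  exists x y, I01 x /\ I01 y /\ Prox f x y /\ ~ SProx f x y.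
Proof.
  intros Hf Hm Hs. set (g := iter f m) in *.
  assert (Hg : continuity g) by (apply iter_continuity, Hf).
  (* The short intervals are chosen once and for all, since both points have to visit the same
     ones. *)
  set (D := fun k => constructive_indefinite_description _
    (horseshoe_short_covers g l r a b c d k Hg Hs)).
  set (p := fun k => proj1_sig (D k)).
  assert (Hp : forall k, exists q, l <= p k /\ q <= r /\ q - p k <= (r - l) / 2 ^ k /\
    covers (iter g k) (p k) q l r) by (intros k; exact (proj2_sig (D k))).
  clearbody p. clear D.
  set (q := fun k => proj1_sig (constructive_indefinite_description _ (Hp k))).
  assert (Hq : forall k, l <= p k /\ q k <= r /\ q k - p k <= (r - l) / 2 ^ k /\
    covers (iter g k) (p k) (q k) l r)
    by (intros k; exact (proj2_sig (constructive_indefinite_description _ (Hp k)))).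
  clearbody q. clear Hp.
  destruct Hs as (HI & HK & C1 & C2).
  destruct (follow_blocks g p q l r a b) as (x & Hx & Hxk); try lra; try assumption.
  { intros k; destruct (Hq k) as (? & ? & _ & ?); auto. }
  destruct (follow_blocks g p q l r c d) as (y & Hy & Hyk); try lra; try assumption.
  { intros k; destruct (Hq k) as (? & ? & _ & ?); auto. }
  exists x, y; split; [exact Hx|split; [exact Hy|split]].
  - intros eta He N.
    destruct (pow_lt_1_zero (1 / 2)) with (y := eta) as [K HK'];
      [rewrite Rabs_right; lra|lra|].
    (* [K] makes $2^{-k}$ smaller than [eta]; the rest makes the block start at time [N] or
       later. *)
    set (k := (K + N + 2)%nat). specialize (HK' k ltac:(unfold k; lia)).
    exists (block_start k * m)%nat; split; [unfold block_start, k; nia|].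
    rewrite <- odist_iter. fold g. unfold odist.
    destruct (Hxk k) as [Hx1 _], (Hyk k) as [Hy1 _], (Hq k) as (_ & _ & Hlen & _).
    assert (E : (1 / 2) ^ k = / 2 ^ k) by (unfold Rdiv; rewrite Rmult_1_l; apply pow_inv).
    assert (0 < / 2 ^ k) by (apply Rinv_0_lt_compat, pow_lt; lra).
    rewrite E, Rabs_right in HK' by lra. unfold Rdiv in Hlen.
    assert ((r - l) * / 2 ^ k <= 1 * / 2 ^ k) by (apply Rmult_le_compat_r; lra).
    apply Rabs_def1; lra.
  - intros HSP.
    destruct (iterates_uniform f m (c - b) (proj1 Hf)) as [eta [He Hun]]; [lra|].
    destruct (HSP eta He (fun n => eta <= odist f x y n)) as [n [Hn Hn']];
      [|exact (Rlt_not_le _ _ Hn Hn')].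
    (* Closeness below [eta] at any time would persist to the next multiple of [m], where the points
       are in different legs. Block [S L] rather than [L] keeps this multiple inside the block. *)
    intros L. set (k := S L). exists ((block_start k + k) * m)%nat. intros i Hi.
    apply Rnot_lt_le; intros Hlt.
    destruct (next_multiple m ((block_start k + k) * m + i) Hm) as (s & n & Hsm & Hn).
    assert (Hnk : (block_start k + k <= n < block_start k + k + k)%nat).
    { assert (k = S L) by reflexivity. set (s0 := (block_start k + k)%nat) in *.
      clearbody k s0. split; apply Nat.nlt_ge || apply Nat.nle_gt; intros Hc.
      - assert (S n * m <= s0 * m)%nat by (apply Nat.mul_le_mono_r; lia). lia.
      - assert ((s0 + S L) * m <= n * m)%nat by (apply Nat.mul_le_mono_r; lia).
        assert (L <= L * m)%nat by nia. lia. }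
    destruct (Hxk k) as [_ Hx2], (Hyk k) as [_ Hy2].
    specialize (Hx2 (n - (block_start k + k))%nat ltac:(lia)).
    specialize (Hy2 (n - (block_start k + k))%nat ltac:(lia)).
    rewrite <- iter_add in Hx2, Hy2.
    replace (k + (n - (block_start k + k)) + block_start k)%nat with n in Hx2, Hy2 by lia.
    unfold g in Hx2, Hy2. rewrite iter_mul, Hn, iter_add in Hx2, Hy2.
    specialize (Hun s _ _ Hsm (iter_I01 f ((block_start k + k) * m + i) x Hf Hx)
      (iter_I01 f ((block_start k + k) * m + i) y Hf Hy) Hlt).
    apply Rabs_def2 in Hun. lra.
Qed.

(** * Counting paths in a tree *)

Fixpoint nsum (n : nat) (F : nat -> nat) : nat :=
  match n with O => O | S n => (nsum n F + F n)%nat end.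

Lemma nsum_le (n : nat) (F G : nat -> nat) :
  (forall i, (i < n)%nat -> (F i <= G i)%nat) -> (nsum n F <= nsum n G)%nat.
Proof.
  induction n as [|n IH]; simpl; intros H; [lia|].
  assert (H' := H n ltac:(lia)). assert (nsum n F <= nsum n G)%nat by (apply IH; intros; apply H; lia).
  lia.
Qed.

Lemma nsum_add (n : nat) (F G : nat -> nat) :
  nsum n (fun i => (F i + G i)%nat) = (nsum n F + nsum n G)%nat.
Proof. induction n as [|n IH]; simpl; lia. Qed.

Lemma nsum_mul_r (n c : nat) (F : nat -> nat) :
  nsum n (fun i => (F i * c)%nat) = (nsum n F * c)%nat.
Proof. induction n as [|n IH]; simpl; nia. Qed.

Lemma nsum_0 (n : nat) : nsum n (fun _ => 0%nat) = 0%nat.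
Proof. induction n as [|n IH]; simpl; lia. Qed.

Lemma nsum_swap (n m : nat) (F : nat -> nat -> nat) :
  nsum n (fun i => nsum m (F i)) = nsum m (fun j => nsum n (fun i => F i j)).
Proof.
  induction n as [|n IH]; simpl; [now rewrite nsum_0|]. now rewrite IH, <- nsum_add.
Qed.

Lemma nsum_shift (n : nat) (F : nat -> nat) :
  nsum (S n) F = (F 0%nat + nsum n (fun i => F (S i)))%nat.
Proof. induction n as [|n IH]; [simpl; lia|]. simpl in *. lia. Qed.

Lemma nsum_bound (n c : nat) (F : nat -> nat) :
  (forall i, (i < n)%nat -> (F i <= c)%nat) -> (nsum n F <= n * c)%nat.
Proof.
  induction n as [|n IH]; simpl; intros H; [lia|].
  assert (H' := H n ltac:(lia)). assert (nsum n F <= n * c)%nat by (apply IH; intros; apply H; lia).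
  lia.
Qed.

Lemma nsum_unique (n : nat) (P : nat -> bool) :
  (forall i j, P i = true -> P j = true -> i = j) ->
  (nsum n (fun i => if P i then 1 else 0) <= 1)%nat.
Proof.
  intros H.
  assert (Hz : forall m, P m = true ->
    nsum m (fun i => if P i then 1%nat else 0%nat) = 0%nat).
  { intros m Hm. apply Nat.le_0_r.
    eapply Nat.le_trans; [apply (nsum_le m _ (fun _ => 0%nat))|now rewrite nsum_0].
    intros i Hi. destruct (P i) eqn:E; [specialize (H i m E Hm)|]; simpl; lia. }
  induction n as [|n IH]; simpl; [lia|].
  destruct (P n) eqn:E; [rewrite (Hz n E)|]; lia.
Qed.

Lemma nsum_single (n a c : nat) : (nsum n (fun i => if i =? a then c else 0) <= c)%nat.
Proof.
  assert (H : (nsum n (fun i => if i =? a then 1 else 0) <= 1)%nat).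
  { apply (nsum_unique n (fun i => i =? a)).
    intros i j Hi Hj. apply Nat.eqb_eq in Hi, Hj. congruence. }
  apply Nat.le_trans with (nsum n (fun i => (if i =? a then 1 else 0) * c))%nat.
  - apply nsum_le. intros i _. destruct (i =? a); simpl; lia.
  - rewrite nsum_mul_r. nia.
Qed.

Lemma nsum_ge1 (n : nat) (F : nat -> nat) : (1 <= nsum n F)%nat ->
  exists i, (i < n)%nat /\ (1 <= F i)%nat.
Proof.
  induction n as [|n IH]; simpl; intros H; [lia|].
  destruct (F n) eqn:E; [|exists n; lia].
  destruct IH as [i Hi]; [lia|]. exists i; lia.
Qed.

Lemma nsum_ge2 (n : nat) (F : nat -> nat) : (2 <= nsum n F)%nat ->
  (exists i, (i < n)%nat /\ (2 <= F i)%nat) \/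
  (exists i j, (i < n)%nat /\ (j < n)%nat /\ i <> j /\ (1 <= F i)%nat /\ (1 <= F j)%nat).
Proof.
  induction n as [|n IH]; simpl; intros H; [lia|].
  destruct (le_lt_dec 2 (F n)) as [H2|H2]; [left; exists n; lia|].
  destruct (Nat.eq_dec (F n) 1) as [H1|H1].
  - destruct (nsum_ge1 n F) as [i Hi]; [lia|]. right; exists i, n; lia.
  - destruct IH as [[i Hi]|(i & j & Hij)]; [lia|left; exists i; lia|right; exists i, j; lia].
Qed.

Lemma nsum_ge_term (n i : nat) (F : nat -> nat) : (i < n)%nat -> (F i <= nsum n F)%nat.
Proof.
  induction n as [|n IH]; simpl; intros H; [lia|].
  destruct (Nat.eq_dec i n) as [->|]; [lia|]. specialize (IH ltac:(lia)). lia.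
Qed.

(* A tree of states: the [j]-th child [next t j] of [t] exists when [meets t j]
   holds, and is the reference state [home j] when moreover [full t j] holds. *)
Record tree := Tree {
  state : Type;
  width : nat;
  next : state -> nat -> state;
  meets : state -> nat -> bool;
  full : state -> nat -> bool;
  home : nat -> state;
  full_meets : forall t j, full t j = true -> meets t j = true;
  full_next : forall t j, full t j = true -> next t j = home j
}.

(** [V] restricts the full steps only. It is enlarged by one reference state at a time in
    [paths_growth]. *)
Fixpoint paths (X : tree) (V : nat -> bool) (n : nat) (t : state X) : nat :=
  match n with
  | O => 1%nat
  | S n => nsum (width X) (fun j =>
      if (meets X t j && (negb (full X t j) || V j))%bool
      then paths X V n (next X t j) else 0%nat)
  end.

(* The paths of length [n + 1] whose last step is a full one to [home a]. *)
Fixpoint paths_to (X : tree) (a : nat) (n : nat) (t : state X) : nat :=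
  match n with
  | O => if full X t a then 1%nat else 0%nat
  | S n => nsum (width X) (fun j =>
      if meets X t j then paths_to X a n (next X t j) else 0%nat)
  end.


(** A path is cut at its first full step to [home a] that [V] forbids: before it the path obeys [V],
    after it the path starts afresh at [home a]. *)
Lemma paths_first_visit (X : tree) (V V' : nat -> bool) (a n : nat) (t : state X) :
  (forall j, V' j = true -> V j = true \/ j = a) ->
  (paths X V' n t <= paths X V n t +
     nsum n (fun i => paths X V i t * paths X V' (n - 1 - i) (home X a)))%nat.
Proof.
  intros HV. revert t; induction n as [|n IH]; intros t; [simpl; lia|].
  set (H := fun i => paths X V' i (home X a)).
  rewrite nsum_shift.
  set (ok := fun j => (meets X t j && (negb (full X t j) || V j))%bool).
  apply Nat.le_trans with (nsum (width X) (fun j =>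
    (if ok j then paths X V n (next X t j) else 0) +
    (if j =? a then H n else 0) +
    nsum n (fun i => (if ok j then paths X V i (next X t j) else 0) * H (n - 1 - i))))%nat.
  - simpl. apply nsum_le. intros j _. unfold ok.
    destruct (meets X t j); simpl; [|lia].
    destruct (full X t j) eqn:Ef; simpl.
    + destruct (V' j) eqn:EV'; [|lia]. destruct (V j) eqn:EV.
      * specialize (IH (next X t j)). unfold H. lia.
      * destruct (HV j EV') as [Hj|E]; [congruence|subst j].
        rewrite Nat.eqb_refl, (full_next X t a Ef). unfold H. lia.
    + specialize (IH (next X t j)). unfold H. lia.
  - rewrite !nsum_add, nsum_swap. simpl (paths X V 0 t).
    assert (Hs := nsum_single (width X) a (H n)).
    assert (E : (nsum n (fun i => nsum (width X) (fun j =>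
      (if ok j then paths X V i (next X t j) else 0) * H (n - 1 - i))) =
      nsum n (fun i => paths X V (S i) t * paths X V' (S n - 1 - S i) (home X a)))%nat).
    { assert (Hle : forall m, (m <= n)%nat -> (nsum m (fun i => nsum (width X) (fun j =>
        (if ok j then paths X V i (next X t j) else 0) * H (n - 1 - i))) =
        nsum m (fun i => paths X V (S i) t * paths X V' (S n - 1 - S i) (home X a)))%nat);
        [|now apply Hle].
      induction m as [|m IHm]; intros Hm; [reflexivity|].
      cbn [nsum]. rewrite IHm by lia. f_equal. rewrite nsum_mul_r.
      replace (S n - 1 - S m)%nat with (n - 1 - m)%nat by lia. reflexivity. }
    rewrite E. replace (S n - 1 - 0)%nat with n by lia.
    unfold H in *.
    change (paths X V (S n) t) with
      (nsum (width X) (fun j => if ok j then paths X V n (next X t j) else 0%nat)). lia.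
Qed.

(** Here a path is cut at its last full step to [home a] that [V] forbids, so the initial part is
    counted by [paths_to] and the remainder obeys [V]. *)
Lemma paths_last_visit (X : tree) (V V' : nat -> bool) (a n : nat) (t : state X) :
  (forall j, V' j = true -> V j = true \/ j = a) ->
  (paths X V' n t <= paths X V n t +
     nsum n (fun i => paths_to X a i t * paths X V (n - 1 - i) (home X a)))%nat.
Proof.
  intros HV. revert t; induction n as [|n IH]; intros t; [simpl; lia|].
  set (H := fun i => paths X V i (home X a)).
  rewrite nsum_shift.
  set (ok := fun j => (meets X t j && (negb (full X t j) || V j))%bool).
  apply Nat.le_trans with (nsum (width X) (fun j =>
    (if ok j then paths X V n (next X t j) else 0) +
    (if j =? a then (if full X t a then 1 else 0) * H n else 0) +
    nsum n (fun i => (if meets X t j then paths_to X a i (next X t j) else 0) * H (n - 1 - i))))%nat.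
  - simpl. apply nsum_le. intros j _. unfold ok.
    destruct (meets X t j); simpl; [|lia].
    destruct (full X t j) eqn:Ef; simpl.
    + destruct (V' j) eqn:EV'; [|lia]. destruct (V j) eqn:EV.
      * specialize (IH (next X t j)). unfold H. lia.
      * destruct (HV j EV') as [Hj|E]; [congruence|subst j]. specialize (IH (next X t a)).
        rewrite Nat.eqb_refl, Ef.
        rewrite (full_next X t a Ef) in *. unfold H. lia.
    + specialize (IH (next X t j)). unfold H. lia.
  - rewrite !nsum_add, nsum_swap.
    assert (Hs := nsum_single (width X) a ((if full X t a then 1 else 0) * H n)).
    assert (E : (nsum n (fun i => nsum (width X) (fun j =>
      (if meets X t j then paths_to X a i (next X t j) else 0) * H (n - 1 - i))) =
      nsum n (fun i => paths_to X a (S i) t * paths X V (S n - 1 - S i) (home X a)))%nat).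
    { assert (Hle : forall m, (m <= n)%nat -> (nsum m (fun i => nsum (width X) (fun j =>
        (if meets X t j then paths_to X a i (next X t j) else 0) * H (n - 1 - i))) =
        nsum m (fun i => paths_to X a (S i) t * paths X V (S n - 1 - S i) (home X a)))%nat);
        [|now apply Hle].
      induction m as [|m IHm]; intros Hm; [reflexivity|].
      cbn [nsum]. rewrite IHm by lia. f_equal. rewrite nsum_mul_r.
      replace (S n - 1 - S m)%nat with (n - 1 - m)%nat by lia. reflexivity. }
    rewrite E. replace (S n - 1 - 0)%nat with n by lia.
    unfold H in *.
    change (paths X V (S n) t) with
      (nsum (width X) (fun j => if ok j then paths X V n (next X t j) else 0%nat)).
    change (paths_to X a 0 t) with (if full X t a then 1%nat else 0%nat). lia.
Qed.

(** Induction on the number of reference states that full steps may enter. With none, every step is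
    partial and has at most two choices. A new state costs only a polynomial factor, because it has
    at most one loop of each length. *)
Lemma paths_growth (X : tree) (k : nat) : (k <= width X)%nat ->
  (forall t, (nsum (width X) (fun j =>
    if (meets X t j && negb (full X t j))%bool then 1 else 0) <= 2)%nat) ->
  (forall a n, (a < width X)%nat -> (paths_to X a n (home X a) <= 1)%nat) ->
  exists C d, forall n t,
    (paths X (fun j => j <? k) n t <= C * ((n + 1) ^ d * 2 ^ n))%nat.
Proof.
  intros Hk Hpartial Hloop. induction k as [|k IH].
  - exists 1%nat, 0%nat. induction n as [|n IHn]; intros t; [simpl; lia|].
    cbn [paths].
    apply Nat.le_trans with (nsum (width X) (fun j =>
      (if (meets X t j && negb (full X t j))%bool then 1 else 0) * 2 ^ n))%nat.
    + apply nsum_le. intros j _. specialize (IHn (next X t j)).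
      replace (j <? 0)%nat with false by (symmetry; apply Nat.ltb_ge; lia).
      rewrite Bool.orb_false_r.
      destruct (meets X t j && negb (full X t j))%bool; simpl in *; lia.
    + rewrite nsum_mul_r. specialize (Hpartial t). simpl. nia.
  - destruct IH as (C & d & HC); [lia|].
    set (V := fun j => (j <? k)%nat) in *. set (V' := fun j => (j <? S k)%nat).
    assert (HV : forall j, V' j = true -> V j = true \/ j = k).
    { intros j Hj. unfold V, V' in *. apply Nat.ltb_lt in Hj.
      destruct (Nat.eq_dec j k) as [|Hne]; [now right|left]. apply Nat.ltb_lt; lia. }
    (* From [home k] itself the cut at the last visit leaves at most one initial part per length,
       hence one more factor [n + 1]. *)
    assert (Hhome : forall n, (paths X V' n (home X k) <= C * ((n + 1) ^ (d + 1) * 2 ^ n))%nat).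
    { intros n. eapply Nat.le_trans; [apply (paths_last_visit X V V' k n _ HV)|].
      assert (Hn := HC n (home X k)).
      assert (Hs : (nsum n (fun i => paths_to X k i (home X k) *
        paths X V (n - 1 - i) (home X k)) <= n * (C * ((n + 1) ^ d * 2 ^ n)))%nat).
      { apply nsum_bound. intros i Hi. specialize (Hloop k i Hk).
        specialize (HC (n - 1 - i)%nat (home X k)).
        assert ((n - 1 - i + 1) ^ d * 2 ^ (n - 1 - i) <= (n + 1) ^ d * 2 ^ n)%nat.
        { apply Nat.mul_le_mono; [apply Nat.pow_le_mono_l|apply Nat.pow_le_mono_r]; lia. }
        nia. }
      rewrite Nat.pow_add_r, Nat.pow_1_r. nia. }
    (* The cut at the first visit gives at most [n] products of a bound of degree [d] with one of
       degree [d + 1]; the powers of 2 multiply to at most [2 ^ n]. *)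
    exists (C + C * C)%nat, (d + (d + 1) + 1)%nat. intros n t.
    eapply Nat.le_trans; [apply (paths_first_visit X V V' k n t HV)|].
    assert (Hpow : forall e e' : nat, (e <= e')%nat -> ((n + 1) ^ e <= (n + 1) ^ e')%nat)
      by (intros; apply Nat.pow_le_mono_r; lia).
    assert (Hs : (nsum n (fun i => paths X V i t * paths X V' (n - 1 - i) (home X k))
      <= n * (C * C * ((n + 1) ^ (d + (d + 1)) * 2 ^ n)))%nat).
    { apply nsum_bound. intros i Hi.
      apply Nat.le_trans with (C * ((n + 1) ^ d * 2 ^ i) *
        (C * ((n + 1) ^ (d + 1) * 2 ^ (n - 1 - i))))%nat.
      - apply Nat.mul_le_mono.
        + eapply Nat.le_trans; [apply HC|]. apply Nat.mul_le_mono_l, Nat.mul_le_mono_r.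
          apply Nat.pow_le_mono_l; lia.
        + eapply Nat.le_trans; [apply Hhome|]. apply Nat.mul_le_mono_l, Nat.mul_le_mono_r.
          apply Nat.pow_le_mono_l; lia.
      - assert (E2 : (2 ^ i * 2 ^ (n - 1 - i) <= 2 ^ n)%nat).
        { rewrite <- Nat.pow_add_r. apply Nat.pow_le_mono_r; lia. }
        rewrite (Nat.pow_add_r (n + 1) d (d + 1)).
        apply (Nat.mul_le_mono_l _ _ (C * C * ((n + 1) ^ d * (n + 1) ^ (d + 1)))) in E2.
        lia. }
    assert (H1 := HC n t).
    assert (H2 := Hpow d (d + (d + 1) + 1)%nat ltac:(lia)).
    rewrite Nat.pow_add_r, Nat.pow_1_r in H2 |- *.
    set (Q := ((n + 1) ^ (d + (d + 1)))%nat) in *.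
    apply (Nat.mul_le_mono_r _ _ (2 ^ n)), (Nat.mul_le_mono_l _ _ C) in H2.
    assert (H3 : (n * (C * C * (Q * 2 ^ n)) <= (n + 1) * (C * C * (Q * 2 ^ n)))%nat)
      by (apply Nat.mul_le_mono_r; lia).
    lia.
Qed.

(** * Tame maps have zero entropy *)

Definition rleb (a b : R) : bool := if Rle_dec a b then true else false.

Lemma rleb_true (a b : R) : rleb a b = true <-> a <= b.
Proof. unfold rleb; destruct (Rle_dec a b); split; intros; auto; discriminate || contradiction. Qed.

Lemma rleb_false (a b : R) : rleb a b = false <-> b < a.
Proof.
  unfold rleb; destruct (Rle_dec a b); split; intros; try discriminate; try lra; reflexivity.
Qed.

(** For continuous $g$ and a nonempty interval $t$ this says that $t'$ is exactly $g(t)$; empty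
    intervals are left unconstrained. *)
Definition image_spec (g : R -> R) (t t' : R * R) : Prop :=
  fst t <= snd t -> covers g (fst t) (snd t) (fst t') (snd t') /\
    forall s, fst t <= s <= snd t -> fst t' <= g s <= snd t'.

Definition image (g : R -> R) (t : R * R) : R * R :=
  epsilon (inhabits (0, 0)) (image_spec g t).

Lemma image_correct (g : R -> R) (t : R * R) : continuity g -> image_spec g t (image g t).
Proof.
  intros Hg. unfold image. apply epsilon_spec. destruct (Rle_dec (fst t) (snd t)) as [Hle|Hn].
  - destruct (continuity_ab_maj g _ _ Hle (fun c _ => Hg c)) as [M [HM HM']].
    destruct (continuity_ab_min g _ _ Hle (fun c _ => Hg c)) as [m [Hm Hm']].
    exists (g m, g M). intros _; simpl. split; [split; [exists m|exists M]|]; auto with real.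
  - exists (0, 0). intros H; contradiction.
Qed.

Definition node (N j : nat) : R := INR j / INR N.

Lemma node_S (N j : nat) : (1 <= N)%nat -> node N (S j) = node N j + / INR N.
Proof.
  intros HN. unfold node. rewrite S_INR. field. apply not_0_INR; lia.
Qed.

Lemma node_le (N i j : nat) : (1 <= N)%nat -> (i <= j)%nat -> node N i <= node N j.
Proof.
  intros HN Hij. apply Rmult_le_compat_r; [|now apply le_INR].
  left; apply Rinv_0_lt_compat, lt_0_INR; lia.
Qed.

Lemma node_lt (N j : nat) : (1 <= N)%nat -> node N j < node N (S j).
Proof.
  intros HN. rewrite node_S by exact HN.
  assert (0 < / INR N) by (apply Rinv_0_lt_compat, lt_0_INR; lia). lra.
Qed.

Lemma node_I01 (N j : nat) : (1 <= N)%nat -> (j <= N)%nat -> I01 (node N j).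
Proof.
  intros HN Hj. split.
  - replace 0 with (node N 0) by (unfold node; simpl; lra). apply node_le; lia.
  - replace 1 with (node N N) by (unfold node; apply Rdiv_diag, not_0_INR; lia).
    now apply node_le.
Qed.

(** The pieces are closed, so a node may be counted in two of them; this is harmless for upper
    bounds. *)
Definition in_piece (N j : nat) (y : R) : bool := (rleb (node N j) y && rleb y (node N (S j)))%bool.

Lemma in_piece_true (N j : nat) (y : R) :
  in_piece N j y = true <-> node N j <= y <= node N (S j).
Proof. unfold in_piece. now rewrite Bool.andb_true_iff, !rleb_true. Qed.

Lemma piece_exists (N : nat) (y : R) : (1 <= N)%nat -> I01 y ->
  exists j, (j < N)%nat /\ in_piece N j y = true.
Proof.
  intros HN Hy.
  assert (H : forall M, (1 <= M)%nat -> y <= node N M ->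
    exists j, (j < M)%nat /\ node N j <= y <= node N (S j)).
  { induction M as [|M IH]; intros HM HyM; [lia|].
    destruct (Rle_dec (node N M) y) as [Hle|Hn]; [exists M; split; [lia|lra]|].
    destruct M as [|M]; [unfold node in Hn; simpl in Hn; unfold I01 in Hy; lra|].
    destruct IH as [j [Hj Hj']]; [lia|lra|]. exists j; split; [lia|exact Hj']. }
  destruct (H N HN) as [j [Hj Hj']].
  - replace (node N N) with 1 by (symmetry; unfold node; apply Rdiv_diag, not_0_INR; lia).
    apply Hy.
  - exists j; split; [exact Hj|]. now apply in_piece_true.
Qed.

(** The part of the image of $t$ in the $j$-th piece; it is a partial or a full piece according to
    [grid_full]. *)
Definition grid_next (g : R -> R) (N : nat) (t : R * R) (j : nat) : R * R :=
  (Rmax (fst (image g t)) (node N j), Rmin (snd (image g t)) (node N (S j))).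

Definition grid_meets (g : R -> R) (N : nat) (t : R * R) (j : nat) : bool :=
  rleb (fst (grid_next g N t j)) (snd (grid_next g N t j)).

Definition grid_full (g : R -> R) (N : nat) (t : R * R) (j : nat) : bool :=
  (grid_meets g N t j &&
    (rleb (fst (image g t)) (node N j) && rleb (node N (S j)) (snd (image g t))))%bool.

Definition grid_home (N j : nat) : R * R := (node N j, node N (S j)).

Lemma grid_full_meets (g : R -> R) (N : nat) (t : R * R) (j : nat) :
  grid_full g N t j = true -> grid_meets g N t j = true.
Proof. unfold grid_full. now intros H%Bool.andb_true_iff. Qed.

Lemma grid_full_next (g : R -> R) (N : nat) (t : R * R) (j : nat) :
  grid_full g N t j = true -> grid_next g N t j = grid_home N j.
Proof.
  unfold grid_full. rewrite !Bool.andb_true_iff, !rleb_true. intros (_ & H1 & H2).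
  unfold grid_next, grid_home. now rewrite Rmax_right, Rmin_right.
Qed.

Definition grid_tree (g : R -> R) (N : nat) : tree :=
  Tree (R * R) N (grid_next g N) (grid_meets g N) (grid_full g N) (grid_home N)
    (grid_full_meets g N) (grid_full_next g N).

(* A partial child contains an end point of the image in a half-open piece. *)
Lemma grid_partial (g : R -> R) (N : nat) (t : R * R) : (1 <= N)%nat ->
  (nsum N (fun j => if (grid_meets g N t j && negb (grid_full g N t j))%bool
     then 1 else 0) <= 2)%nat.
Proof.
  intros HN. set (lo := fst (image g t)). set (hi := snd (image g t)).
  set (P := fun j => (negb (rleb lo (node N j)) && rleb lo (node N (S j)))%bool).
  set (Q := fun j => (rleb (node N j) hi && negb (rleb (node N (S j)) hi))%bool).
  assert (HP : (nsum N (fun j => if P j then 1 else 0) <= 1)%nat).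
  { apply nsum_unique. intros i j. unfold P.
    rewrite !Bool.andb_true_iff, !Bool.negb_true_iff, !rleb_true, !rleb_false.
    intros Hi Hj. destruct (Nat.lt_trichotomy i j) as [H|[H|H]]; [|exact H|].
    - apply (node_le N) in H; [lra|exact HN].
    - apply (node_le N) in H; [lra|exact HN]. }
  assert (HQ : (nsum N (fun j => if Q j then 1 else 0) <= 1)%nat).
  { apply nsum_unique. intros i j. unfold Q.
    rewrite !Bool.andb_true_iff, !Bool.negb_true_iff, !rleb_true, !rleb_false.
    intros Hi Hj. destruct (Nat.lt_trichotomy i j) as [H|[H|H]]; [|exact H|].
    - apply (node_le N) in H; [lra|exact HN].
    - apply (node_le N) in H; [lra|exact HN]. }
  apply Nat.le_trans with
    (nsum N (fun j => (if P j then 1 else 0) + (if Q j then 1 else 0)))%nat;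
    [|rewrite nsum_add; lia].
  apply nsum_le. intros j _.
  destruct (grid_meets g N t j) eqn:Em; simpl; [|lia].
  unfold grid_full. rewrite Em; simpl. fold lo hi.
  apply rleb_true in Em. unfold grid_next in Em; simpl in Em. fold lo hi in Em.
  assert (lo <= Rmax lo (node N j)) by apply Rmax_l.
  assert (node N j <= Rmax lo (node N j)) by apply Rmax_r.
  assert (Rmin hi (node N (S j)) <= hi) by apply Rmin_l.
  assert (Rmin hi (node N (S j)) <= node N (S j)) by apply Rmin_r.
  unfold P, Q.
  replace (rleb lo (node N (S j))) with true by (symmetry; apply rleb_true; lra).
  replace (rleb (node N j) hi) with true by (symmetry; apply rleb_true; lra).
  destruct (rleb lo (node N j)), (rleb (node N (S j)) hi); simpl; lia.
Qed.

Lemma grid_next_meets (g : R -> R) (N : nat) (t : R * R) (j : nat) :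
  grid_meets g N t j = true ->
  fst (grid_next g N t j) <= snd (grid_next g N t j) /\
  fst (image g t) <= fst (grid_next g N t j) /\ node N j <= fst (grid_next g N t j) /\
  snd (grid_next g N t j) <= snd (image g t) /\ snd (grid_next g N t j) <= node N (S j).
Proof.
  intros H. apply rleb_true in H. repeat split; [exact H| | | |]; simpl;
    auto using Rmax_l, Rmax_r, Rmin_l, Rmin_r.
Qed.

Lemma grid_pullback (g : R -> R) (N a n j : nat) (t : R * R) (u v : R) : continuity g ->
  fst t <= snd t -> grid_meets g N t j = true ->
  fst (grid_next g N t j) <= u -> u < v -> v <= snd (grid_next g N t j) ->
  covers (iter g (S n)) u v (node N a) (node N (S a)) ->
  exists u' v', fst t <= u' /\ u' < v' /\ v' <= snd t /\
    covers (iter g (S (S n))) u' v' (node N a) (node N (S a)) /\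
    forall s, u' < s < v' -> u < g s < v.
Proof.
  intros Hg Ht Hm Hu Huv Hv Hc.
  destruct (grid_next_meets g N t j Hm) as (_ & H1 & _ & H2 & _).
  destruct (image_correct g t Hg Ht) as [Hcov _].
  destruct (pullback g (fst t) (snd t) u v Hg Huv) as (u' & v' & Hu' & Huv' & Hv' & C & _ & I).
  { apply (covers_sub g _ _ _ _ _ _ Hcov); lra. }
  exists u', v'; repeat (split; [assumption|]). split; [|exact I].
  replace (S (S n)) with (S n + 1)%nat by lia.
  exact (covers_iter_add g (S n) 1 _ _ _ _ _ _ Hg C Hc).
Qed.

(** The final full piece is pulled back along the path, one child at a time. *)
Lemma grid_path_cover (g : R -> R) (N a n : nat) (t : R * R) : continuity g -> (1 <= N)%nat ->
  fst t <= snd t -> (1 <= paths_to (grid_tree g N) a n t)%nat ->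
  exists u v, fst t <= u /\ u < v /\ v <= snd t /\
    covers (iter g (S n)) u v (node N a) (node N (S a)).
Proof.
  intros Hg HN; revert t; induction n as [|n IH]; intros t Ht Hp.
  - cbn in Hp. destruct (grid_full g N t a) eqn:Ef; [|lia].
    unfold grid_full in Ef. rewrite !Bool.andb_true_iff, !rleb_true in Ef.
    destruct (image_correct g t Hg Ht) as [Hcov _].
    assert (Hc : covers g (fst t) (snd t) (node N a) (node N (S a)))
      by (apply (covers_sub g _ _ _ _ _ _ Hcov); tauto).
    exists (fst t), (snd t). repeat split; try lra; try apply Hc.
    apply (covers_lt _ _ _ _ _ (node_lt N a HN) Hc).
  - cbn in Hp. apply nsum_ge1 in Hp as (j & Hj & Hp).
    destruct (grid_meets g N t j) eqn:Em; [|lia].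
    destruct (grid_next_meets g N t j Em) as (Hne & _).
    destruct (IH _ Hne Hp) as (u & v & Hu & Huv & Hv & Hc).
    destruct (grid_pullback g N a n j t u v) as (u' & v' & H1 & H2 & H3 & H4 & _); try assumption.
    now exists u', v'.
Qed.

(** Two paths with the same first child are apart by induction; different first children lie in
    different pieces, and pullbacks keep them apart. *)
Lemma grid_path_apart (g : R -> R) (N a n : nat) (t : R * R) : continuity g -> (1 <= N)%nat ->
  fst t <= snd t -> (2 <= paths_to (grid_tree g N) a n t)%nat ->
  exists u v u' v', (fst t <= u /\ u < v /\ v <= snd t /\
    covers (iter g (S n)) u v (node N a) (node N (S a))) /\
    (fst t <= u' /\ u' < v' /\ v' <= snd t /\
    covers (iter g (S n)) u' v' (node N a) (node N (S a))) /\ apart u v u' v'.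
Proof.
  intros Hg HN; revert t; induction n as [|n IH]; intros t Ht Hp.
  - cbn in Hp. destruct (grid_full g N t a); lia.
  - cbn in Hp. apply nsum_ge2 in Hp as [(j & Hj & Hp)|(j & k & Hj & Hk & Hjk & Hpj & Hpk)].
    + destruct (grid_meets g N t j) eqn:Em; [|lia].
      destruct (grid_next_meets g N t j Em) as (Hne & _).
      destruct (IH _ Hne Hp) as (u & v & u' & v' & (A1 & A2 & A3 & A4) & (B1 & B2 & B3 & B4) & Hap).
      destruct (grid_pullback g N a n j t u v) as (p & q & C1 & C2 & C3 & C4 & C5); try assumption.
      destruct (grid_pullback g N a n j t u' v') as (p' & q' & D1 & D2 & D3 & D4 & D5); try assumption.
      exists p, q, p', q'. repeat (split; [tauto|]).
      now apply (pullback_apart g p q p' q' u v u' v').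
    + destruct (grid_meets g N t j) eqn:Ej; [|lia].
      destruct (grid_meets g N t k) eqn:Ek; [|lia].
      destruct (grid_next_meets g N t j Ej) as (Hne & _ & Hlj & _ & Hrj).
      destruct (grid_next_meets g N t k Ek) as (Hne' & _ & Hlk & _ & Hrk).
      destruct (grid_path_cover g N a n _ Hg HN Hne Hpj) as (u & v & A1 & A2 & A3 & A4).
      destruct (grid_path_cover g N a n _ Hg HN Hne' Hpk) as (u' & v' & B1 & B2 & B3 & B4).
      destruct (grid_pullback g N a n j t u v) as (p & q & C1 & C2 & C3 & C4 & C5); try assumption.
      destruct (grid_pullback g N a n k t u' v') as (p' & q' & D1 & D2 & D3 & D4 & D5); try assumption.
      exists p, q, p', q'. repeat (split; [tauto|]).
      apply (pullback_apart g p q p' q' u v u' v'); try assumption.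
      intros s Hs Hs'. destruct (Nat.lt_total j k) as [H|[H|H]]; [|contradiction|].
      * apply (node_le N) in H; [lra|exact HN].
      * apply (node_le N) in H; [lra|exact HN].
Qed.

Lemma tame_grid_loops (g : R -> R) (N a n : nat) : continuity g -> tame g -> (1 <= N)%nat ->
  (a < N)%nat -> (paths_to (grid_tree g N) a n (grid_home N a) <= 1)%nat.
Proof.
  intros Hg Htame HN Ha. apply Nat.nlt_ge; intros H2.
  assert (Hlt := node_lt N a HN).
  destruct (grid_path_apart g N a n (grid_home N a) Hg HN) as
    (u & v & u' & v' & (A1 & A2 & A3 & A4) & (B1 & B2 & B3 & B4) & Hap);
    [simpl; lra|exact H2|]. simpl in *.
  apply (Htame (S n)); [lia|].
  apply (apart_horseshoe (iter g (S n)) (node N a) (node N (S a)) u v u' v'); try assumption;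
    apply (node_I01 N); lia.
Qed.

Lemma length_le_nsum {A : Type} (N : nat) (P : nat -> A -> bool) (S : list A) :
  (forall x, In x S -> exists j, (j < N)%nat /\ P j x = true) ->
  (length S <= nsum N (fun j => length (filter (P j) S)))%nat.
Proof.
  induction S as [|x S IH]; intros H; [simpl; lia|].
  apply Nat.le_trans with
    (nsum N (fun j => (if P j x then 1 else 0) + length (filter (P j) S)))%nat.
  - rewrite nsum_add. destruct (H x (or_introl eq_refl)) as [j [Hj Hj']].
    assert (H1 := nsum_ge_term N j (fun j => if P j x then 1%nat else 0%nat) Hj).
    simpl in H1. rewrite Hj' in H1.
    specialize (IH ltac:(intros; apply H; now right)). simpl. lia.
  - apply nsum_le. intros j _. simpl. destruct (P j x); simpl; lia.
Qed.

(** Points of $t$ are too close to be separated at time 0, so separation is inherited by their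
    images, which are sorted by the piece that they enter. A path of $n$ steps accounts for the
    $n+1$ times $0,\dots,n$. *)
Lemma separated_le_paths (g : R -> R) (N n : nat) (t : R * R) (S : list R) :
  interval_map g -> (1 <= N)%nat -> (forall x, In x S -> fst t <= x <= snd t) ->
  snd t - fst t <= / INR N -> separated g (Datatypes.S n) (/ INR N) S ->
  (length S <= paths (grid_tree g N) (fun j => j <? N) n t)%nat.
Proof.
  intros Hg HN; revert t S; induction n as [|n IH]; intros t S HS Ht (Hnd & HI & Hsep).
  - destruct S as [|x [|y S]]; simpl; try lia. exfalso.
    destruct (Hsep x y) as (k & Hk & Hk'); [simpl; auto|simpl; auto| |].
    + inversion Hnd as [|? ? Hn _]; subst. intros ->. apply Hn; simpl; auto.
    + assert (Hx := HS x ltac:(simpl; auto)). assert (Hy := HS y ltac:(simpl; auto)).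
      replace k with 0%nat in Hk' by lia. unfold odist, iter in Hk'; simpl in Hk'.
      assert (Rabs (x - y) <= / INR N) by (apply Rabs_le; lra). lra.
  - eapply Nat.le_trans.
    { apply (length_le_nsum N (fun j x => in_piece N j (g x))).
      intros x Hx. apply piece_exists; [exact HN|]. apply Hg, HI, Hx. }
    cbn [paths width grid_tree]. apply nsum_le. intros j Hj.
    cbn [meets full next grid_tree].
    replace (j <? N) with true by (symmetry; now apply Nat.ltb_lt).
    rewrite Bool.orb_true_r, Bool.andb_true_r.
    set (F := filter (fun x => in_piece N j (g x)) S).
    assert (HF : forall x, In x F -> In x S /\ node N j <= g x <= node N (Datatypes.S j)).
    { intros x Hx. apply filter_In in Hx as [Hx Hx']. now apply in_piece_true in Hx'. }
    assert (Hin : forall x, In x F ->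
      fst (grid_next g N t j) <= g x <= snd (grid_next g N t j)).
    { intros x Hx. destruct (HF x Hx) as [Hx1 Hx2]. specialize (HS x Hx1).
      destruct (image_correct g t (proj1 Hg)) as [_ Him]; [lra|].
      specialize (Him x HS). unfold grid_next; simpl.
      split; [apply Rmax_lub|apply Rmin_glb]; lra. }
    destruct (grid_meets g N t j) eqn:Em.
    + rewrite <- (length_map g F). apply IH.
      * intros y Hy. apply in_map_iff in Hy as (x & <- & Hx). now apply Hin.
      * destruct (grid_next_meets g N t j Em) as (_ & _ & Hl & _ & Hr).
        rewrite node_S in Hr by exact HN. lra.
      * assert (Hsep' : forall x y, In x F -> In y F -> x <> y ->
          exists k, (k < Datatypes.S n)%nat /\ odist g (g x) (g y) k > / INR N).
        { intros x y Hx Hy Hxy. destruct (HF x Hx) as [Hx1 _], (HF y Hy) as [Hy1 _].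
          destruct (Hsep x y Hx1 Hy1 Hxy) as ([|k] & Hk & Hk').
          - assert (Hx2 := HS x Hx1). assert (Hy2 := HS y Hy1).
            unfold odist, iter in Hk'; simpl in Hk'.
            assert (Rabs (x - y) <= / INR N) by (apply Rabs_le; lra). lra.
          - exists k; split; [lia|]. now rewrite <- odist_S. }
        split; [|split].
        -- apply NoDup_map_NoDup_ForallPairs; [|now apply NoDup_filter].
           intros x y Hx Hy E. apply NNPP; intros Hxy.
           destruct (Hsep' x y Hx Hy Hxy) as (k & _ & Hk). unfold odist in Hk.
           rewrite E, Rminus_diag, Rabs_R0 in Hk.
           assert (0 < / INR N) by (apply Rinv_0_lt_compat, lt_0_INR; lia). lra.
        -- intros y Hy. apply in_map_iff in Hy as (x & <- & Hx).
           apply Hg, HI. now apply HF.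
        -- intros y y' Hy Hy' Hne. apply in_map_iff in Hy as (x & <- & Hx).
           apply in_map_iff in Hy' as (x' & <- & Hx'). apply Hsep'; congruence.
    + destruct F as [|x F']; [simpl; lia|]. exfalso.
      specialize (Hin x (or_introl eq_refl)). apply rleb_false in Em. lra.
Qed.

Lemma tame_separated_growth (g : R -> R) (N : nat) : interval_map g -> tame g ->
  (1 <= N)%nat -> exists C d, forall n S, separated g (Datatypes.S n) (/ INR N) S ->
  (length S <= C * ((n + 1) ^ d * 2 ^ n))%nat.
Proof.
  intros Hg Htame HN.
  destruct (paths_growth (grid_tree g N) N) as (C & d & H).
  - apply le_n.
  - intros t. now apply grid_partial.
  - intros a n Ha. apply tame_grid_loops; try assumption. apply Hg.
  - exists (N * C)%nat, d. intros n S (Hnd & HI & Hsep).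
    eapply Nat.le_trans; [apply (length_le_nsum N (in_piece N))|].
    { intros x Hx. apply piece_exists; [exact HN|now apply HI]. }
    rewrite <- Nat.mul_assoc. apply nsum_bound. intros j Hj.
    eapply Nat.le_trans; [|apply (H n (grid_home N j))].
    apply separated_le_paths; try assumption.
    + intros x Hx. apply filter_In in Hx as [_ Hx]. now apply in_piece_true in Hx.
    + simpl. rewrite node_S by exact HN. lra.
    + split; [now apply NoDup_filter|split].
      * intros x Hx. apply filter_In in Hx as [Hx _]. now apply HI.
      * intros x y Hx Hy. apply filter_In in Hx as [Hx _]. apply filter_In in Hy as [Hy _].
        now apply Hsep.
Qed.

(** For $d\ge 1$ and $q=\lfloor n/d\rfloor$ one has $n+1\le d(q+1)\le d\,2^q$; the $d$-th power is
    at most $d^d2^n$. *)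
Lemma polynomial_le_exponential (d : nat) : exists D, forall n, ((n + 1) ^ d <= D * 2 ^ n)%nat.
Proof.
  destruct d as [|d].
  - exists 1%nat. intros n. simpl. assert (2 ^ n <> 0)%nat by (apply Nat.pow_nonzero; lia). lia.
  - exists (S d ^ S d)%nat. intros n.
    assert (E := Nat.div_mod_eq n (S d)). assert (Hlt := Nat.mod_upper_bound n (S d) ltac:(lia)).
    assert (Hq := Nat.pow_gt_lin_r 2 (n / S d) ltac:(lia)).
    apply Nat.le_trans with ((S d * 2 ^ (n / S d)) ^ S d)%nat.
    + apply Nat.pow_le_mono_l. nia.
    + rewrite Nat.pow_mul_l, <- Nat.pow_mul_r. apply Nat.mul_le_mono_l, Nat.pow_le_mono_r; lia.
Qed.

Lemma pow2_le_exp (n : nat) : INR (2 ^ n) <= exp (INR n).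
Proof.
  induction n as [|n IH]; [simpl; rewrite exp_0; lra|].
  rewrite S_INR, exp_plus. cbn [Nat.pow]. rewrite mult_INR. change (INR 2) with 2.
  assert (2 < exp 1) by (assert (H := exp_ineq1 1); lra).
  assert (0 < exp (INR n)) by apply exp_pos. nra.
Qed.

Lemma tame_not_pos_entropy (f : R -> R) : interval_map f -> tame f -> ~ pos_entropy f.
Proof.
  intros Hf Htame (eps & c & Heps & Hc & Hent).
  (* With $cm\ge 3$ and $q=\lfloor n/m\rfloor$, positive entropy yields at least $e^{3q}\ge 2^{3q}$
     points, whereas tameness of $f^m$ allows at most $A\,2^{2q}$: one factor $2^q$ from the paths,
     one absorbing the polynomial. *)
  destruct (INR_unbounded (3 / c)) as [m Hm].
  assert (Hm0 : 0 < INR m) by (assert (0 < 3 / c) by (apply Rdiv_lt_0_compat; lra); lra).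
  assert (Hm1 : (1 <= m)%nat) by (destruct m; [simpl in Hm0; lra|lia]).
  assert (Hcm : 3 <= c * INR m).
  { apply (Rmult_lt_compat_l c) in Hm; [|exact Hc].
    replace (c * (3 / c)) with 3 in Hm by (field; lra). lra. }
  (* Separation by [eps] at time [k] under [f] forces separation by [delta], hence by [/ INR N], at
     time [k / m] under [iter f m]. *)
  destruct (iterates_uniform f m eps (proj1 Hf) Heps) as [delta [Hdelta Hun]].
  destruct (archimed_cor1 delta Hdelta) as [N [HN HN0]].
  destruct (tame_separated_growth (iter f m) N) as (C & d & HC);
    [now apply interval_map_iter|now apply tame_iter|lia|].
  destruct (polynomial_le_exponential d) as [D HD].
  set (A := (C * D)%nat).
  (* A time of at least [A * m] gives [A <= q < 2 ^ q], which makes the two bounds contradictory. *)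
  destruct (Hent (A * m)%nat) as (n & Hn & _ & S & (Hnd & HI & Hsep) & Hexp).
  assert (E := Nat.div_mod_eq n m). assert (Hlt := Nat.mod_upper_bound n m ltac:(lia)).
  set (q := (n / m)%nat) in *.
  assert (HAq : (A <= q)%nat) by nia.
  assert (HS : (length S <= C * ((q + 1) ^ d * 2 ^ q))%nat).
  { apply HC. split; [exact Hnd|split; [exact HI|]].
    intros x y Hx Hy Hxy. destruct (Hsep x y Hx Hy Hxy) as (k & Hk & Hk').
    assert (Ek := Nat.div_mod_eq k m). assert (Hkm := Nat.mod_upper_bound k m ltac:(lia)).
    exists (k / m)%nat; split; [apply Nat.lt_succ_r; apply Nat.Div0.div_le_mono; lia|].
    apply Rnot_le_lt; intros Hle. unfold odist in Hk', Hle.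
    rewrite Ek, Nat.add_comm, !(iter_add f (k mod m)), (Nat.mul_comm m), <- !iter_mul in Hk'.
    assert (HxI := iter_I01 (iter f m) (k / m) x (interval_map_iter f m Hf) (HI x Hx)).
    assert (HyI := iter_I01 (iter f m) (k / m) y (interval_map_iter f m Hf) (HI y Hy)).
    specialize (Hun (k mod m)%nat _ _ Hkm HxI HyI ltac:(lra)). lra. }
  assert (Hup : (C * ((q + 1) ^ d * 2 ^ q) <= A * 2 ^ (q + q))%nat).
  { rewrite Nat.pow_add_r. unfold A.
    assert (Hd := Nat.mul_le_mono_l _ _ C (Nat.mul_le_mono_r _ _ (2 ^ q) (HD q))). lia. }
  assert (Hlow : INR (2 ^ (q + (q + q))) <= INR (length S)).
  { eapply Rle_trans; [apply pow2_le_exp|]. eapply Rle_trans; [|exact Hexp].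
    assert (H3 : INR (q + (q + q)) <= c * INR n).
    { apply Rle_trans with (c * (INR m * INR q)).
      - rewrite !plus_INR, <- Rmult_assoc. 
        assert (Hq := Rmult_le_compat_r (INR q) _ _ (pos_INR q) Hcm). lra.
      - rewrite <- mult_INR. apply Rmult_le_compat_l; [lra|]. apply le_INR; lia. }
    destruct H3 as [H3|H3]; [left; now apply exp_increasing|right; now rewrite H3]. }
  apply INR_le in Hlow. rewrite Nat.pow_add_r in Hlow.
  assert (Hqlin := Nat.pow_gt_lin_r 2 q ltac:(lia)).
  assert (2 ^ (q + q) <> 0)%nat by (apply Nat.pow_nonzero; lia).
  nia.
Qed.

(** * The equivalence *)

Lemma not_tame_strict_horseshoe (g : R -> R) : continuity g -> ~ tame g ->
  exists m l r a b c d, (1 <= m)%nat /\ strict_horseshoe (iter g m) l r a b c d.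
Proof.
  intros Hg Hn. apply NNPP; intros Hnone. apply Hn. intros m Hm Hh.
  destruct (horseshoe_strict (iter g m) (iter_continuity g m Hg) Hh)
    as (l & r & a & b & c & d & HI & HK & C1 & C2).
  apply Hnone. exists (2 * m)%nat, l, r, a, b, c, d. split; [lia|].
  assert (E : forall u v, covers (iter (iter g m) 2) u v l r -> covers (iter g (2 * m)) u v l r).
  { intros u v [[s [Hs Hs']] [t [Ht Ht']]]. rewrite iter_mul in Hs', Ht'.
    split; [exists s|exists t]; tauto. }
  repeat split; try tauto; now apply E.
Qed.

Lemma pos_entropy_iff_proximal (g : R -> R) : interval_map g ->
  pos_entropy g <-> exists x y, I01 x /\ I01 y /\ Prox g x y /\ ~ SProx g x y.
Proof.
  intros Hg; split.
  - intros Hent. destruct (not_tame_strict_horseshoe g (proj1 Hg))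
      as (m & l & r & a & b & c & d & Hm & Hs).
    { intros Ht. now apply (tame_not_pos_entropy g Hg Ht). }
    now apply (horseshoe_Prox_not_SProx g m l r a b c d).
  - intros (x & y & Hx & Hy & Hp & Hsp). destruct (not_tame_strict_horseshoe g (proj1 Hg))
      as (m & l & r & a & b & c & d & Hm & Hs).
    { intros Ht. now apply Hsp, tame_Prox_SProx. }
    apply (horseshoe_entropy g m l r a b c d); try assumption. apply Hg.
Qed.

(** * Extension of a map of the unit interval to the line *)

Definition clamp (x : R) : R := Rmax 0 (Rmin 1 x).

Lemma clamp_I01 (x : R) : I01 (clamp x).
Proof. unfold I01, clamp, Rmax, Rmin. destruct (Rle_dec 1 x), (Rle_dec 0 _); lra. Qed.

Lemma clamp_id (x : R) : I01 x -> clamp x = x.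
Proof. intros [H0 H1]. unfold clamp. now rewrite Rmin_right, Rmax_right. Qed.

Lemma clamp_lipschitz (x y : R) : Rabs (clamp x - clamp y) <= Rabs (x - y).
Proof.
  unfold clamp, Rmax, Rmin, Rabs.
  destruct (Rle_dec 1 x), (Rle_dec 1 y); repeat destruct (Rle_dec 0 _);
    repeat destruct (Rcase_abs _); lra.
Qed.

Definition extend (f : R -> R) (x : R) : R := f (clamp x).

Lemma extend_interval_map (f : R -> R) : maps_I01 f -> cont_I01 f -> interval_map (extend f).
Proof.
  intros Hm Hc; split; [|intros x _; apply Hm, clamp_I01].
  intros x eps He. destruct (Hc (clamp x) (clamp_I01 x) eps He) as [d [Hd H]].
  exists d; split; [exact Hd|]. intros y [_ Hy].
  apply H; [apply clamp_I01|]. eapply Rle_lt_trans; [apply clamp_lipschitz|exact Hy].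
Qed.

Lemma iter_extend (f : R -> R) (n : nat) (x : R) : maps_I01 f -> I01 x ->
  I01 (iter f n x) /\ iter (extend f) n x = iter f n x.
Proof.
  intros Hm Hx; induction n as [|n [HI IH]]; [now split|].
  rewrite !iter_S, IH. split; [now apply Hm|]. unfold extend. now rewrite clamp_id.
Qed.

Lemma odist_extend (f : R -> R) (x y : R) (n : nat) : maps_I01 f -> I01 x -> I01 y ->
  odist (extend f) x y n = odist f x y n.
Proof.
  intros Hm Hx Hy. unfold odist.
  now rewrite (proj2 (iter_extend f n x Hm Hx)), (proj2 (iter_extend f n y Hm Hy)).
Qed.

Lemma pos_entropy_extend (f : R -> R) : maps_I01 f -> pos_entropy (extend f) <-> pos_entropy f.
Proof.
  intros Hm. split; intros (eps & c & He & Hc & H); exists eps, c;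
    (split; [exact He|split; [exact Hc|]]); intros N;
    destruct (H N) as (n & Hn & Hn1 & S & (Hnd & HI & Hsep) & Hexp);
    exists n; (split; [exact Hn|split; [exact Hn1|]]);
    exists S; (split; [split; [exact Hnd|split; [exact HI|]]|exact Hexp]);
    intros x y Hx Hy Hxy; destruct (Hsep x y Hx Hy Hxy) as (k & Hk & Hk');
    exists k; (split; [exact Hk|]); [rewrite <- odist_extend|rewrite odist_extend]; auto.
Qed.

Lemma Prox_extend (f : R -> R) (x y : R) : maps_I01 f -> I01 x -> I01 y ->
  Prox (extend f) x y <-> Prox f x y.
Proof.
  intros Hm Hx Hy. split; intros H eta He N; destruct (H eta He N) as (n & Hn & Hn');
    exists n; (split; [exact Hn|]); [rewrite <- odist_extend|rewrite odist_extend]; auto.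
Qed.

Lemma SProx_extend (f : R -> R) (x y : R) : maps_I01 f -> I01 x -> I01 y ->
  SProx (extend f) x y <-> SProx f x y.
Proof.
  intros Hm Hx Hy. split; intros H eta He B HB; destruct (H eta He B HB) as (n & Hn & Hn');
    exists n; (split; [|exact Hn']); [rewrite <- odist_extend|rewrite odist_extend]; auto.
Qed.

Lemma Asy_refl (f : R -> R) (x : R) : Asy f x x.
Proof.
  intros eta He. exists 0%nat. intros n _. unfold odist. now rewrite Rminus_diag, Rabs_R0.
Qed.

Lemma Asy_sym (f : R -> R) (x y : R) : Asy f x y -> Asy f y x.
Proof.
  intros H eta He. destruct (H eta He) as [N HN]. exists N. intros n Hn.
  unfold odist. rewrite Rabs_minus_sym. now apply HN.
Qed.

Lemma limsup_ge_sym (f : R -> R) (x y eps : R) : limsup_ge f x y eps -> limsup_ge f y x eps.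
Proof.
  intros H d Hd N. destruct (H d Hd N) as (n & Hn & Hn'). exists n; split; [exact Hn|].
  unfold odist. now rewrite Rabs_minus_sym.
Qed.

(** An [eta] for which asymptoticity fails is exceeded or attained at arbitrarily late times, so it
    serves as [eps]. *)
Lemma not_Asy_limsup (f : R -> R) (x y : R) : ~ Asy f x y ->
  exists eps, eps > 0 /\ limsup_ge f x y eps.
Proof.
  intros HA. apply NNPP; intros Hnone. apply HA. intros eta He.
  apply NNPP; intros HN. apply Hnone. exists eta; split; [exact He|]. intros d Hd N.
  apply NNPP; intros Hn. apply HN. exists N. intros n Hle. apply Rnot_le_lt; intros Hge.
  apply Hn. exists n; split; [exact Hle|lra].
Qed.

(* A single pair is already a scrambled set. *)
Lemma proximal_pair_scrambled (f : R -> R) (x y : R) : Prox f x y -> ~ SProx f x y ->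
  exists eps, eps > 0 /\ scrambled f eps (fun s => s = x \/ s = y) /\
    forall s t, s = x \/ s = y -> t = x \/ t = y -> s <> t -> Prox f s t /\ ~ SProx f s t.
Proof.
  intros Hp Hsp.
  assert (HA : ~ Asy f x y) by (intros H; now apply Hsp, Asy_SProx).
  assert (Hxy : x <> y) by (intros <-; apply HA, Asy_refl).
  destruct (not_Asy_limsup f x y HA) as (eps & He & Hls).
  exists eps; split; [exact He|split; [split|]].
  - exists x, y; auto.
  - intros s t [->| ->] [->| ->] Hst; try congruence.
    + now split.
    + split; [now apply Prox_sym|split; [|now apply limsup_ge_sym]].
      intros H; now apply HA, Asy_sym.
  - intros s t [->| ->] [->| ->] Hst; try congruence.
    + now split.
    + split; [now apply Prox_sym|]. intros H; now apply Hsp, SProx_sym.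
Qed.

Theorem theorem7p12 (f : R -> R) (Hmap : maps_I01 f) (Hcont : cont_I01 f) :
  (pos_entropy f <->
     exists x y, I01 x /\ I01 y /\ Prox f x y /\ ~ SProx f x y) /\
  (pos_entropy f <->
     exists eps (S : R -> Prop), eps > 0 /\ (forall x, S x -> I01 x) /\
       scrambled f eps S /\
       forall x y, S x -> S y -> x <> y -> Prox f x y /\ ~ SProx f x y).
Proof.
  assert (Hpair : pos_entropy f <->
    exists x y, I01 x /\ I01 y /\ Prox f x y /\ ~ SProx f x y).
  { rewrite <- (pos_entropy_extend f Hmap).
    rewrite (pos_entropy_iff_proximal _ (extend_interval_map f Hmap Hcont)).
    split; intros (x & y & Hx & Hy & Hp & Hsp); exists x, y;
      (split; [exact Hx|split; [exact Hy|]]);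
      [rewrite <- Prox_extend, <- SProx_extend|rewrite Prox_extend, SProx_extend]; auto. }
  split; [exact Hpair|]. rewrite Hpair. split.
  - intros (x & y & Hx & Hy & Hp & Hsp).
    destruct (proximal_pair_scrambled f x y Hp Hsp) as (eps & He & Hscr & Hall).
    exists eps, (fun s => s = x \/ s = y).
    split; [exact He|split; [|split; [exact Hscr|exact Hall]]].
    intros s [->| ->]; assumption.
  - intros (eps & S & _ & HS & [(x & y & Hx & Hy & Hxy) _] & Hall).
    destruct (Hall x y Hx Hy Hxy). exists x, y; auto.
Qed.
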